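(* For every (untyped) term $t$ of the exponential substitution calculus, if $t$ is strongly normalizing for $\to_{\mathrm{ss}}$ then $t$ is strongly normalizing for $\to_{\mathrm{ms}}$.
   Context: Exponential substitution calculus. Variables: multiplicative $m,n,o,\ldots$ and exponential $e,f,g,\ldots$ (disjoint kinds); $x,y,z$ range over both. Multiplicative values $v_{\mathsf m} ::= m \mid (t,s) \mid \lambda x.t$; exponential values $v_{\mathsf e} ::= e \mid\ !t$; values $v ::= v_{\mathsf m}\mid v_{\mathsf e}$. Terms: $t,s,u ::= v \mid \mathsf{cut}(v,x.t) \mid \mathsf{par}(m,x.y.t) \mid \mathsf{sub}(m,v,x.t) \mid \mathsf{der}(e,x.t)$; in $\lambda x.t$, cut, sub, der $x$ is bound in $t$, in par $x,y$ are bound; terms up to $\alpha$; $\mathrm{fv}$ = free variables. Left contexts $L ::= \langle\cdot\rangle \mid \mathsf{cut}(v,x.L)\mid\mathsf{par}(m,x.y.L)\mid\mathsf{sub}(m,v,x.L)\mid\mathsf{der}(e,x.L)$; every term is uniquely $L\langle v\rangle$. Value contexts $V ::= \langle\cdot\rangle \mid (C,s)\mid (t,C)\mid\lambda x.C\mid\ !C$; general contexts $C ::= V \mid \mathsf{cut}(V,x.t)\mid\mathsf{sub}(m,V,x.t)\mid L\langle C\rangle$; multiplicative value contexts $V_{\mathsf m} ::= \langle\cdot\rangle\mid (M,s)\mid(t,M)\mid\lambda x.M$; multiplicative contexts $M ::= V_{\mathsf m}\mid \mathsf{cut}(V_{\mathsf m},x.t)\mid \mathsf{sub}(m,V_{\mathsf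 m},x.t)\mid L\langle M\rangle$. Plugging $C\langle t\rangle$ replaces the hole (may capture), except that if $t=L\langle v\rangle$ then $\mathsf{cut}(\langle\cdot\rangle,x.s)\langle t\rangle := L\langle\mathsf{cut}(v,x.s)\rangle$ and $\mathsf{sub}(m,\langle\cdot\rangle,x.s)\langle t\rangle := L\langle\mathsf{sub}(m,v,x.s)\rangle$; $C\langle\!\langle t\rangle\!\rangle$ is capture-avoiding plugging. Meta-level substitution $\{v_{\mathsf e}/e\}t$ (capture-avoiding) commutes with all constructors, is the identity on variables other than $e$, $\{v_{\mathsf e}/e\}e := v_{\mathsf e}$, and $\{f/e\}\mathsf{der}(e,x.t) := \mathsf{der}(f,x.\{f/e\}t)$, $\{!L\langle v\rangle/e\}\mathsf{der}(e,x.t) := L\langle \mathsf{cut}(v,x.\{!L\langle v\rangle/e\}t)\rangle$. For multiplicative $m,n$, $\{n/m\}t$ is renaming. Root rules (context does not capture the cut variable): (ax$_{m1}$) $\mathsf{cut}(v_{\mathsf m},m.M\langle\!\langle m\rangle\!\rangle)\mapsto M\langle\!\langle v_{\mathsf m}\rangle\!\rangle$; (ax$_{m2}$) $\mathsf{cut}(n,m.t)\mapsto \{n/m\}t$; ($\otimes$) $\mathsf{cut}((s,u),m.M\langle\mathsf{par}(m,x.y.t)\rangle)\mapsto M\langle L\langle\mathsf{cut}(v,x.L'\langle\mathsf{cut}(v',y.t)\rangle)\rangle\rangle$ where $s=L\langle v\rangle$, $u=L'\langle v'\rangle$; ($\multimap$) $\mathsf{cut}(\lambda y.s,m.M\langle\mathsf{sub}(m,v,x.t)\rangle)\mapsto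 M\langle\mathsf{cut}(v,y.L\langle\mathsf{cut}(v',x.t)\rangle)\rangle$ where $s=L\langle v'\rangle$; (ax$_{e1}$) $\mathsf{cut}(v_{\mathsf e},e.C\langle\!\langle e\rangle\!\rangle)\mapsto\mathsf{cut}(v_{\mathsf e},e.C\langle\!\langle v_{\mathsf e}\rangle\!\rangle)$; (ax$_{e2}$) $\mathsf{cut}(f,e.C\langle\mathsf{der}(e,x.t)\rangle)\mapsto\mathsf{cut}(f,e.C\langle\mathsf{der}(f,x.t)\rangle)$; (!der) $\mathsf{cut}(!s,e.C\langle\mathsf{der}(e,x.t)\rangle)\mapsto\mathsf{cut}(!s,e.C\langle L\langle\mathsf{cut}(v,x.t)\rangle\rangle)$ where $s=L\langle v\rangle$; (w) $\mathsf{cut}(v_{\mathsf e},e.t)\mapsto t$ if $e\notin\mathrm{fv}(t)$; (ess) $\mathsf{cut}(v_{\mathsf e},e.t)\mapsto\{v_{\mathsf e}/e\}t$. Each induces $\to_a$ by closure under general contexts. $\to_{\mathsf m}$ = union of ax$_{m1}$, ax$_{m2}$, $\otimes$, $\multimap$; $\to_{\mathrm{ms}} = \to_{\mathsf m}\cup\to_{ax_{e1}}\cup\to_{ax_{e2}}\cup\to_{!der}\cup\to_w$ (micro-step); $\to_{\mathrm{ss}}=\to_{\mathsf m}\cup\to_{\mathrm{ess}}$ (small-step). A term is strongly normalizing for $\to$ if it has no infinite $\to$-reduction sequence.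
   Formalization: Terms are assumed proper: each bound multiplicative variable occurs at most once and no multiplicative variable is free in a promotion !t; otherwise the multiplicative rules may leave bound occurrences dangling and the claim fails. *)

(* Defs.v *)
From Stdlib Require Import Arith.

(** Terms up to alpha are represented in de Bruijn style. There are two
    independent index spaces, one per kind of variable: crossing a binder of
    kind [k] shifts the indices of kind [k] only. Free variables are the indices
    that point beyond all the enclosing binders of their kind. *)

Inductive kind := Mul | Exp.

Inductive mulval :=
| MVar (m : nat)
| MPair (t s : term)
| MLam (k : kind) (t : term)
with expval :=
| EVar (e : nat)
| EBang (t : term)
with val :=
| VM (v : mulval)
| VE (v : expval)
with term :=
| Val (v : val)
| Cut (v : val) (k : kind) (t : term)
| Par (m : nat) (kx ky : kind) (t : term) (* in par(m,x.y.t), y is innermost *)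
| Sub (m : nat) (v : val) (k : kind) (t : term)
| Der (e : nat) (k : kind) (t : term).

Definition renaming := kind -> nat -> nat.

Definition up (k : kind) (r : renaming) : renaming := fun k' i =>
  match k, k' with
  | Mul, Mul | Exp, Exp => match i with 0 => 0 | S j => S (r k' j) end
  | _, _ => r k' i
  end.

Fixpoint ren_m (r : renaming) (v : mulval) : mulval :=
  match v with
  | MVar m => MVar (r Mul m)
  | MPair t s => MPair (ren r t) (ren r s)
  | MLam k t => MLam k (ren (up k r) t)
  end
with ren_e (r : renaming) (v : expval) : expval :=
  match v with
  | EVar e => EVar (r Exp e)
  | EBang t => EBang (ren r t)
  end
with ren_v (r : renaming) (v : val) : val :=
  match v with
  | VM v => VM (ren_m r v)
  | VE v => VE (ren_e r v)
  end
with ren (r : renaming) (t : term) : term :=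
  match t with
  | Val v => Val (ren_v r v)
  | Cut v k t => Cut (ren_v r v) k (ren (up k r) t)
  | Par m kx ky t => Par (r Mul m) kx ky (ren (up ky (up kx r)) t)
  | Sub m v k t => Sub (r Mul m) (ren_v r v) k (ren (up k r) t)
  | Der e k t => Der (r Exp e) k (ren (up k r) t)
  end.

(** A depth records how many binders of each kind have been crossed. *)

Definition depth := kind -> nat.
Definition d0 : depth := fun _ => 0.
Definition d1 (k : kind) : depth := fun k' =>
  match k, k' with Mul, Mul | Exp, Exp => 1 | _, _ => 0 end.
Definition dadd (d d' : depth) : depth := fun k => d k + d' k.

Definition shift (d : depth) : renaming := fun k i => d k + i.

(** The renaming {n/m}, where [m] is the innermost multiplicative variable. *)
Definition minst (n : nat) : renaming := fun k i =>
  match k with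
  | Mul => match i with 0 => n | S j => j end
  | Exp => i
  end.

Inductive lctx :=
| LHole
| LCut (v : val) (k : kind) (L : lctx)
| LPar (m : nat) (kx ky : kind) (L : lctx)
| LSub (m : nat) (v : val) (k : kind) (L : lctx)
| LDer (e : nat) (k : kind) (L : lctx).

Fixpoint lplug (L : lctx) (t : term) : term :=
  match L with
  | LHole => t
  | LCut v k L => Cut v k (lplug L t)
  | LPar m kx ky L => Par m kx ky (lplug L t)
  | LSub m v k L => Sub m v k (lplug L t)
  | LDer e k L => Der e k (lplug L t)
  end.

Fixpoint ldepth (L : lctx) : depth :=
  match L with
  | LHole => d0
  | LCut _ k L | LSub _ _ k L | LDer _ k L => dadd (d1 k) (ldepth L)
  | LPar _ kx ky L => dadd (d1 kx) (dadd (d1 ky) (ldepth L))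
  end.

Fixpoint spine (t : term) : lctx :=
  match t with
  | Val _ => LHole
  | Cut v k t => LCut v k (spine t)
  | Par m kx ky t => LPar m kx ky (spine t)
  | Sub m v k t => LSub m v k (spine t)
  | Der e k t => LDer e k (spine t)
  end.

Fixpoint head (t : term) : val :=
  match t with
  | Val v => v
  | Cut _ _ t | Par _ _ _ t | Sub _ _ _ t | Der _ _ t => head t
  end.

Lemma lplug_spine (t : term) : lplug (spine t) (Val (head t)) = t.
Proof. induction t; simpl; congruence. Qed.

Lemma spine_lplug (L : lctx) (v : val) :
  spine (lplug L (Val v)) = L /\ head (lplug L (Val v)) = v.
Proof. induction L; simpl; intuition congruence. Qed.

(** For s = L<v>: [cut_at s k t] is L<cut(v,x.t)> and [sub_at m s k t] is
    L<sub(m,v,x.t)>, where [t] and [m] live outside the scope of L and L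
    must not capture their variables, whence the shifts. *)

Definition cut_at (s : term) (k : kind) (t : term) : term :=
  lplug (spine s) (Cut (head s) k (ren (up k (shift (ldepth (spine s)))) t)).

Definition sub_at (m : nat) (s : term) (k : kind) (t : term) : term :=
  lplug (spine s)
    (Sub (shift (ldepth (spine s)) Mul m) (head s) k
       (ren (up k (shift (ldepth (spine s)))) t)).

Inductive vctx :=
| VHole
| VPairL (C : gctx) (s : term)
| VPairR (t : term) (C : gctx)
| VLam (k : kind) (C : gctx)
| VBang (C : gctx)
with gctx :=
| CVal (V : vctx)
| CCut (V : vctx) (k : kind) (t : term)
| CSub (m : nat) (V : vctx) (k : kind) (t : term)
| CLeft (L : lctx) (C : gctx).

(** Possibly capturing plugging C<t>. When [V] is not the hole, [vplug V t] is a
    value and [cut_at], [sub_at] are just [Cut], [Sub]; when it is the hole they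
    perform the commutation with the left context of [t]. *)

Fixpoint vplug (V : vctx) (t : term) : term :=
  match V with
  | VHole => t
  | VPairL C s => Val (VM (MPair (plug C t) s))
  | VPairR s C => Val (VM (MPair s (plug C t)))
  | VLam k C => Val (VM (MLam k (plug C t)))
  | VBang C => Val (VE (EBang (plug C t)))
  end
with plug (C : gctx) (t : term) : term :=
  match C with
  | CVal V => vplug V t
  | CCut V k s => cut_at (vplug V t) k s
  | CSub m V k s => sub_at m (vplug V t) k s
  | CLeft L C => lplug L (plug C t)
  end.

Fixpoint vdepth (V : vctx) : depth :=
  match V with
  | VHole => d0
  | VPairL C _ | VPairR _ C | VBang C => gdepth C
  | VLam k C => dadd (d1 k) (gdepth C)
  end
with gdepth (C : gctx) : depth :=
  match C with
  | CVal V | CCut V _ _ | CSub _ V _ _ => vdepth V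
  | CLeft L C => dadd (ldepth L) (gdepth C)
  end.

(** Multiplicative contexts are the general ones whose hole is not under a
    bang. *)

Fixpoint mult_v (V : vctx) : Prop :=
  match V with
  | VHole => True
  | VPairL C _ | VPairR _ C | VLam _ C => mult C
  | VBang _ => False
  end
with mult (C : gctx) : Prop :=
  match C with
  | CVal V | CCut V _ _ | CSub _ V _ _ => mult_v V
  | CLeft _ C => mult C
  end.

Definition esubst := nat -> expval.

Definition up_s (k : kind) (sg : esubst) : esubst :=
  match k with
  | Mul => fun i => ren_e (shift (d1 Mul)) (sg i)
  | Exp => fun i =>
      match i with
      | 0 => EVar 0
      | S j => ren_e (shift (d1 Exp)) (sg j)
      end
  end.

Fixpoint subst_m (sg : esubst) (v : mulval) : mulval :=
  match v with
  | MVar m => MVar m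
  | MPair t s => MPair (subst sg t) (subst sg s)
  | MLam k t => MLam k (subst (up_s k sg) t)
  end
with subst_e (sg : esubst) (v : expval) : expval :=
  match v with
  | EVar e => sg e
  | EBang t => EBang (subst sg t)
  end
with subst_v (sg : esubst) (v : val) : val :=
  match v with
  | VM v => VM (subst_m sg v)
  | VE v => VE (subst_e sg v)
  end
with subst (sg : esubst) (t : term) : term :=
  match t with
  | Val v => Val (subst_v sg v)
  | Cut v k t => Cut (subst_v sg v) k (subst (up_s k sg) t)
  | Par m kx ky t => Par m kx ky (subst (up_s ky (up_s kx sg)) t)
  | Sub m v k t => Sub m (subst_v sg v) k (subst (up_s k sg) t)
  | Der e k t =>
      match sg e with
      | EVar f => Der f k (subst (up_s k sg) t)
      | EBang s => cut_at s k (subst (up_s k sg) t)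
      end
  end.

(** {v/e}t, where [e] is the innermost exponential variable of [t]. *)
Definition esubst1 (v : expval) : esubst := fun i =>
  match i with 0 => v | S j => EVar j end.

Inductive rule :=
| ax_m1 | ax_m2 | tensor | lolli | ax_e1 | ax_e2 | bang_der | weak | ess.

(** From outside a cut on a variable of kind [k] to the hole of the context [C]
    in the body of that cut. The cut variable itself is [gdepth C k] there. *)
Definition into (k : kind) (C : gctx) : renaming :=
  shift (dadd (gdepth C) (d1 k)).

(** In the rules that remove a binder, [r] is the contractum outside its scope;
    the equation with [ren (shift (d1 _)) r] says that the contractum, read
    inside the scope, does not mention the bound variable. *)
Inductive root : rule -> term -> term -> Prop :=
| root_ax_m1 (v : mulval) (M : gctx) (r : term) :
    mult M ->
    plug M (Val (VM (ren_m (into Mul M) v))) = ren (shift (d1 Mul)) r ->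
    root ax_m1 (Cut (VM v) Mul (plug M (Val (VM (MVar (gdepth M Mul)))))) r
| root_ax_m2 (n : nat) (t : term) :
    root ax_m2 (Cut (VM (MVar n)) Mul t) (ren (minst n) t)
| root_tensor (s u : term) (M : gctx) (kx ky : kind) (t r : term) :
    mult M ->
    plug M (cut_at (ren (into Mul M) s) kx
              (cut_at (ren (shift (d1 kx)) (ren (into Mul M) u)) ky t))
      = ren (shift (d1 Mul)) r ->
    root tensor
      (Cut (VM (MPair s u)) Mul (plug M (Par (gdepth M Mul) kx ky t))) r
| root_lolli (ky : kind) (s : term) (M : gctx) (v : val) (kx : kind)
    (t r : term) :
    mult M ->
    plug M (Cut v ky
              (cut_at (ren (up ky (into Mul M)) s) kx
                 (ren (up kx (shift (d1 ky))) t)))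
      = ren (shift (d1 Mul)) r ->
    root lolli
      (Cut (VM (MLam ky s)) Mul (plug M (Sub (gdepth M Mul) v kx t))) r
| root_ax_e1 (v : expval) (C : gctx) :
    root ax_e1
      (Cut (VE v) Exp (plug C (Val (VE (EVar (gdepth C Exp))))))
      (Cut (VE v) Exp (plug C (Val (VE (ren_e (into Exp C) v)))))
| root_ax_e2 (f : nat) (C : gctx) (k : kind) (t : term) :
    root ax_e2
      (Cut (VE (EVar f)) Exp (plug C (Der (gdepth C Exp) k t)))
      (Cut (VE (EVar f)) Exp (plug C (Der (into Exp C Exp f) k t)))
| root_bang_der (s : term) (C : gctx) (k : kind) (t : term) :
    root bang_der
      (Cut (VE (EBang s)) Exp (plug C (Der (gdepth C Exp) k t)))
      (Cut (VE (EBang s)) Exp (plug C (cut_at (ren (into Exp C) s) k t)))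
| root_weak (v : expval) (t r : term) :
    t = ren (shift (d1 Exp)) r ->
    root weak (Cut (VE v) Exp t) r
| root_ess (v : expval) (t : term) :
    root ess (Cut (VE v) Exp t) (subst (esubst1 v) t).

Inductive step (a : rule) : term -> term -> Prop :=
| step_intro (C : gctx) (t s : term) :
    root a t s -> step a (plug C t) (plug C s).

Definition step_m (t s : term) : Prop :=
  step ax_m1 t s \/ step ax_m2 t s \/ step tensor t s \/ step lolli t s.

Definition step_ms (t s : term) : Prop :=
  step_m t s \/ step ax_e1 t s \/ step ax_e2 t s \/ step bang_der t s \/
  step weak t s.

Definition step_ss (t s : term) : Prop := step_m t s \/ step ess t s.

Definition SN (R : term -> term -> Prop) (t : term) : Prop :=
  ~ exists f : nat -> term, f 0 = t /\ forall i, R (f i) (f (S i)).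

(** The index of a multiplicative variable after crossing a binder. *)
Definition mup (k : kind) (i : nat) : nat := d1 k Mul + i.

Definition same (i j : nat) : nat := if i =? j then 1 else 0.

Fixpoint mocc_m (i : nat) (v : mulval) : nat :=
  match v with
  | MVar m => same i m
  | MPair t s => mocc i t + mocc i s
  | MLam k t => mocc (mup k i) t
  end
with mocc_e (i : nat) (v : expval) : nat :=
  match v with
  | EVar _ => 0
  | EBang t => mocc i t
  end
with mocc_v (i : nat) (v : val) : nat :=
  match v with
  | VM v => mocc_m i v
  | VE v => mocc_e i v
  end
with mocc (i : nat) (t : term) : nat :=
  match t with
  | Val v => mocc_v i v
  | Cut v k t => mocc_v i v + mocc (mup k i) t
  | Par m kx ky t => same i m + mocc (mup ky (mup kx i)) t
  | Sub m v k t => same i m + mocc_v i v + mocc (mup k i) t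
  | Der _ k t => mocc (mup k i) t
  end.

(** The variable of kind [k] and index [i] is used at most once if it is
    multiplicative. *)
Definition at_most_once (k : kind) (i : nat) (t : term) : Prop :=
  match k with Mul => mocc i t <= 1 | Exp => True end.

(** Without this condition the multiplicative rules, which remove a cut after
    acting on one single occurrence of its variable, would leave the other
    occurrences unbound. It is implied by typability in linear logic. Bound
    multiplicative variables are only required to be affine, and free ones are
    only required not to occur in promotions. *)
Fixpoint proper_m (v : mulval) : Prop :=
  match v with
  | MVar _ => True
  | MPair t s => proper t /\ proper s
  | MLam k t => at_most_once k 0 t /\ proper t
  end
with proper_e (v : expval) : Prop :=
  match v with
  | EVar _ => True
  | EBang t => (forall i, mocc i t = 0) /\ proper t
  end
with proper_v (v : val) : Prop :=
  match v with
  | VM v => proper_m v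
  | VE v => proper_e v
  end
with proper (t : term) : Prop :=
  match t with
  | Val v => proper_v v
  | Cut v k t => proper_v v /\ at_most_once k 0 t /\ proper t
  | Par _ kx ky t =>
      at_most_once kx (mup ky 0) t /\ at_most_once ky 0 t /\ proper t
  | Sub _ v k t => proper_v v /\ at_most_once k 0 t /\ proper t
  | Der _ k t => at_most_once k 0 t /\ proper t
  end.

(* Main.v *)
(** Induction on small-step reduction reduces the theorem to the following: a term
    whose small-step reducts are all micro-step SN is itself micro-step SN. This
    is proved by structural induction, the only delicate terms being cuts. An
    exponential cut is SN as soon as v and {v/e}t are, because at the root the cut
    is never duplicated: micro-steps in t project to micro-steps in {v/e}t, and
    those acting on the cut itself do not change {v/e}t but consume occurrences of
    e. A multiplicative cut is SN as soon as v, t and the contractum are, because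
    by linearity there is at most one contractum, which can be written as a
    (suitably generalized) substitution of v in t, along which the steps of v and
    t project. *)
Require Import Defs.
From Stdlib Require Import Arith Lia FunctionalExtensionality Relations.
From Stdlib Require Import Classical IndefiniteDescription.

(* Terms are untyped, so the variable of a multiplicative cut may be absent from the body, or occur
   where it clashes with the cut value (a par meeting an abstraction, a sub meeting a pair). Such a
   cut has no root step, and small-step normalization gives no information on a contractum. The
   generalized substitution [inst] is nevertheless total: clashes get an arbitrary meaning that
   commutes with all other operations, and the instance is assumed normalizing only when the cut
   [fires]. It must then be shown that micro-steps inside an inactive cut never activate it. This
   rests on two monotone quantities: on proper terms a step never increases the number of
   occurrences of a free multiplicative variable, and never erases a clash. The other obstacle is
   plugging, which pulls left contexts out of cuts and subs. The argument therefore uses the plain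
   structural closure [cl] and the relation [occ], which replaces one occurrence without mentioning
   contexts; contexts come back only in the final comparison. *)
Scheme mulval_mut := Induction for mulval Sort Prop
with expval_mut := Induction for expval Sort Prop
with val_mut := Induction for val Sort Prop
with term_mut := Induction for term Sort Prop.
Combined Scheme syntax_ind from mulval_mut, expval_mut, val_mut, term_mut.

(** * Algebra of renamings *)

Definition sh (k : kind) : renaming := shift (d1 k).
Definition rid : renaming := fun _ i => i.
Definition rcomp (r r' : renaming) : renaming := fun k i => r k (r' k i).

Ltac renaming_ext :=
  let k := fresh "k" in let i := fresh "i" in
  extensionality k; extensionality i;
  repeat match goal with j : kind |- _ => destruct j end;
  try reflexivity; destruct i; reflexivity.

Lemma up_rid k : up k rid = rid.
Proof. renaming_ext. Qed.

Lemma up_rcomp k r r' : up k (rcomp r r') = rcomp (up k r) (up k r').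
Proof. renaming_ext. Qed.

Lemma up_sh k r : rcomp (up k r) (sh k) = rcomp (sh k) r.
Proof. renaming_ext. Qed.

Lemma shift_d0 : shift d0 = rid.
Proof. reflexivity. Qed.

Lemma shift_dadd d d' : shift (dadd d d') = rcomp (shift d') (shift d).
Proof.
  extensionality k; extensionality i; unfold shift, dadd, rcomp; lia.
Qed.

(** Shifts are additions, hence commute. This order reads [into] as crossing the binder of the cut
    first and then the context. *)
Lemma shift_dadd' d d' : shift (dadd d d') = rcomp (shift d) (shift d').
Proof.
  extensionality k; extensionality i; unfold shift, dadd, rcomp; lia.
Qed.

Lemma ren_rid_all :
  (forall v, ren_m rid v = v) /\ (forall v, ren_e rid v = v) /\
  (forall v, ren_v rid v = v) /\ (forall t, ren rid t = t).
Proof. apply syntax_ind; simpl; intros; rewrite ?up_rid; f_equal; auto. Qed.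

Lemma ren_rid t : ren rid t = t.
Proof. apply ren_rid_all. Qed.
Lemma ren_m_rid t : ren_m rid t = t.
Proof. apply ren_rid_all. Qed.
Lemma ren_e_rid t : ren_e rid t = t.
Proof. apply ren_rid_all. Qed.
Lemma ren_v_rid t : ren_v rid t = t.
Proof. apply ren_rid_all. Qed.

Lemma ren_ren_all :
  (forall v r r', ren_m r (ren_m r' v) = ren_m (rcomp r r') v) /\
  (forall v r r', ren_e r (ren_e r' v) = ren_e (rcomp r r') v) /\
  (forall v r r', ren_v r (ren_v r' v) = ren_v (rcomp r r') v) /\
  (forall t r r', ren r (ren r' t) = ren (rcomp r r') t).
Proof. apply syntax_ind; simpl; intros; rewrite ?up_rcomp; f_equal; auto. Qed.

Lemma ren_ren t r r' : ren r (ren r' t) = ren (rcomp r r') t.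
Proof. apply ren_ren_all. Qed.
Lemma ren_m_ren_m t r r' : ren_m r (ren_m r' t) = ren_m (rcomp r r') t.
Proof. apply ren_ren_all. Qed.
Lemma ren_e_ren_e t r r' : ren_e r (ren_e r' t) = ren_e (rcomp r r') t.
Proof. apply ren_ren_all. Qed.
Lemma ren_v_ren_v t r r' : ren_v r (ren_v r' t) = ren_v (rcomp r r') t.
Proof. apply ren_ren_all. Qed.

Lemma ren_up_sh k r t : ren (up k r) (ren (sh k) t) = ren (sh k) (ren r t).
Proof. rewrite !ren_ren, up_sh; reflexivity. Qed.
Lemma ren_m_up_sh k r t : ren_m (up k r) (ren_m (sh k) t) = ren_m (sh k) (ren_m r t).
Proof. rewrite !ren_m_ren_m, up_sh; reflexivity. Qed.
Lemma ren_e_up_sh k r t : ren_e (up k r) (ren_e (sh k) t) = ren_e (sh k) (ren_e r t).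
Proof. rewrite !ren_e_ren_e, up_sh; reflexivity. Qed.
Lemma ren_v_up_sh k r t : ren_v (up k r) (ren_v (sh k) t) = ren_v (sh k) (ren_v r t).
Proof. rewrite !ren_v_ren_v, up_sh; reflexivity. Qed.

Lemma ren_up_up_sh k k' r t :
  ren (up k' (up k r)) (ren (up k' (sh k)) t) =
  ren (up k' (sh k)) (ren (up k' r) t).
Proof. rewrite !ren_ren, <- !up_rcomp, up_sh; reflexivity. Qed.

(** * Commutation of cuts with left contexts *)

(** The equations for [cut_at] and [sub_at], one per constructor of the term being commuted, replace
    their definitions by [spine] and [head]: later proofs go by plain induction on that term. *)
Lemma cut_at_Val v k t : cut_at (Val v) k t = Cut v k t.
Proof.
  unfold cut_at; simpl; rewrite shift_d0, up_rid, ren_rid; reflexivity.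
Qed.

Lemma cut_at_Cut v k' s k t :
  cut_at (Cut v k' s) k t = Cut v k' (cut_at s k (ren (up k (sh k')) t)).
Proof.
  unfold cut_at; simpl; rewrite ren_ren, shift_dadd, <- up_rcomp; reflexivity.
Qed.

Lemma cut_at_Par m kx ky s k t :
  cut_at (Par m kx ky s) k t =
  Par m kx ky (cut_at s k (ren (up k (sh ky)) (ren (up k (sh kx)) t))).
Proof.
  unfold cut_at; simpl; rewrite !ren_ren, !shift_dadd, <- !up_rcomp; reflexivity.
Qed.

Lemma cut_at_Sub m v k' s k t :
  cut_at (Sub m v k' s) k t = Sub m v k' (cut_at s k (ren (up k (sh k')) t)).
Proof.
  unfold cut_at; simpl; rewrite ren_ren, shift_dadd, <- up_rcomp; reflexivity.
Qed.

Lemma cut_at_Der e k' s k t :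
  cut_at (Der e k' s) k t = Der e k' (cut_at s k (ren (up k (sh k')) t)).
Proof.
  unfold cut_at; simpl; rewrite ren_ren, shift_dadd, <- up_rcomp; reflexivity.
Qed.

Lemma sub_at_Val m v k t : sub_at m (Val v) k t = Sub m v k t.
Proof.
  unfold sub_at; simpl; rewrite shift_d0, up_rid, ren_rid; reflexivity.
Qed.

Lemma sub_at_Cut m v k' s k t :
  sub_at m (Cut v k' s) k t =
  Cut v k' (sub_at (sh k' Mul m) s k (ren (up k (sh k')) t)).
Proof.
  unfold sub_at; simpl; rewrite ren_ren, shift_dadd, <- up_rcomp; reflexivity.
Qed.

Lemma sub_at_Par m m' kx ky s k t :
  sub_at m (Par m' kx ky s) k t =
  Par m' kx ky (sub_at (sh ky Mul (sh kx Mul m)) s k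
                  (ren (up k (sh ky)) (ren (up k (sh kx)) t))).
Proof.
  unfold sub_at; simpl; rewrite !ren_ren, !shift_dadd, <- !up_rcomp; reflexivity.
Qed.

Lemma sub_at_Sub m m' v k' s k t :
  sub_at m (Sub m' v k' s) k t =
  Sub m' v k' (sub_at (sh k' Mul m) s k (ren (up k (sh k')) t)).
Proof.
  unfold sub_at; simpl; rewrite ren_ren, shift_dadd, <- up_rcomp; reflexivity.
Qed.

Lemma sub_at_Der m e k' s k t :
  sub_at m (Der e k' s) k t =
  Der e k' (sub_at (sh k' Mul m) s k (ren (up k (sh k')) t)).
Proof.
  unfold sub_at; simpl; rewrite ren_ren, shift_dadd, <- up_rcomp; reflexivity.
Qed.

#[local] Opaque cut_at sub_at.

#[local] Hint Rewrite cut_at_Val cut_at_Cut cut_at_Par cut_at_Sub cut_at_Der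
  sub_at_Val sub_at_Cut sub_at_Par sub_at_Sub sub_at_Der : at_.

Lemma ren_cut_at s : forall r k t,
  ren r (cut_at s k t) = cut_at (ren r s) k (ren (up k r) t).
Proof.
  induction s; intros; simpl; autorewrite with at_; simpl; f_equal;
  rewrite IHs, ?ren_up_up_sh; reflexivity.
Qed.

(** Associativity: both sides nest the spine of [s], then that of [u], around [t]. The only
    difference is that [t] enters the scope of the binder of kind [k], whence the shift. *)
Lemma cut_at_cut_at s : forall k u k' t,
  cut_at (cut_at s k u) k' t = cut_at s k (cut_at u k' (ren (up k' (sh k)) t)).
Proof.
  induction s; intros; autorewrite with at_; f_equal;
  rewrite IHs, ?ren_cut_at, ?ren_up_up_sh; reflexivity.
Qed.

Lemma ren_sub_at s : forall m r k t,
  ren r (sub_at m s k t) = sub_at (r Mul m) (ren r s) k (ren (up k r) t).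
Proof.
  induction s; intros; simpl; autorewrite with at_; simpl; f_equal;
  rewrite IHs, ?ren_up_up_sh; f_equal;
  repeat match goal with k : kind |- _ => destruct k end; reflexivity.
Qed.

Lemma sub_at_cut_at s : forall m k u k' t,
  sub_at m (cut_at s k u) k' t =
  cut_at s k (sub_at (sh k Mul m) u k' (ren (up k' (sh k)) t)).
Proof.
  induction s; intros; autorewrite with at_; f_equal;
  rewrite IHs, ?ren_sub_at, ?ren_up_up_sh; f_equal; f_equal;
  repeat match goal with k : kind |- _ => destruct k end; reflexivity.
Qed.

(** * Firing a substituted value *)

Definition pfst (w : mulval) : term :=
  match w with MPair s _ => s | _ => Val (VM w) end.
Definition psnd (w : mulval) : term :=
  match w with MPair _ u => u | _ => Val (VM w) end.
Definition lkind (w : mulval) : kind :=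
  match w with MLam k _ => k | _ => Mul end.
Definition lbody (w : mulval) : term :=
  match w with MLam _ s => s | _ => ren (sh Mul) (Val (VM w)) end.

(** [par_at w kx ky t], [sub_to w v k t] and [der_at w k t] are what becomes of
    par(m,x.y.t), sub(m,v,x.t) and der(e,x.t) when the value w is substituted
    for m or e. On clashes w is used both as a pair of copies of itself and as
    a constant function: an arbitrary choice, compatible with renamings and
    with the growth of left contexts. *)
Definition par_at (w : mulval) (kx ky : kind) (t : term) : term :=
  match w with
  | MVar n => Par n kx ky t
  | _ => cut_at (pfst w) kx (cut_at (ren (sh kx) (psnd w)) ky t)
  end.
Definition sub_to (w : mulval) (v : val) (k : kind) (t : term) : term :=
  match w with
  | MVar n => Sub n v k t
  | _ => Cut v (lkind w) (cut_at (lbody w) k (ren (up k (sh (lkind w))) t))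
  end.
Definition der_at (w : expval) (k : kind) (t : term) : term :=
  match w with
  | EVar f => Der f k t
  | EBang s => cut_at s k t
  end.

Lemma ren_lbody r w : ren (up (lkind w) r) (lbody w) = lbody (ren_m r w).
Proof.
  destruct w; try reflexivity; unfold lbody, lkind; rewrite ren_up_sh; reflexivity.
Qed.

Lemma ren_par_at r w kx ky t :
  ren r (par_at w kx ky t) = par_at (ren_m r w) kx ky (ren (up ky (up kx r)) t).
Proof.
  destruct w; [reflexivity| |]; cbn [par_at ren_m];
  rewrite !ren_cut_at, ren_up_sh; reflexivity.
Qed.

Lemma ren_sub_to r w v k t :
  ren r (sub_to w v k t) = sub_to (ren_m r w) (ren_v r v) k (ren (up k r) t).
Proof.
  destruct w; [reflexivity| |]; unfold sub_to; fold (ren_m r);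
  cbn [ren ren_m lkind]; f_equal;
  rewrite ren_cut_at, ren_up_up_sh; f_equal;
  apply (ren_lbody r (MPair t0 s)) || apply (ren_lbody r (MLam k0 t0)).
Qed.

Lemma ren_der_at r w k t :
  ren r (der_at w k t) = der_at (ren_e r w) k (ren (up k r) t).
Proof. destruct w; simpl; auto using ren_cut_at. Qed.

Lemma cut_at_par_at w kx ky s k t :
  cut_at (par_at w kx ky s) k t =
  par_at w kx ky (cut_at s k (ren (up k (sh ky)) (ren (up k (sh kx)) t))).
Proof.
  destruct w; unfold par_at; autorewrite with at_; auto;
  rewrite !cut_at_cut_at; reflexivity.
Qed.

Lemma cut_at_sub_to w v k' s k t :
  cut_at (sub_to w v k' s) k t = sub_to w v k' (cut_at s k (ren (up k (sh k')) t)).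
Proof.
  destruct w; unfold sub_to; autorewrite with at_; auto; f_equal;
  rewrite cut_at_cut_at, ren_cut_at, ren_up_up_sh; reflexivity.
Qed.

Lemma cut_at_der_at w k' s k t :
  cut_at (der_at w k' s) k t = der_at w k' (cut_at s k (ren (up k (sh k')) t)).
Proof.
  destruct w; unfold der_at; autorewrite with at_; auto using cut_at_cut_at.
Qed.

(** * Simultaneous substitution of values for variables of both kinds *)

Definition upm (k : kind) (sm : nat -> mulval) : nat -> mulval :=
  match k with
  | Mul => fun i =>
      match i with 0 => MVar 0 | S j => ren_m (sh Mul) (sm j) end
  | Exp => fun i => ren_m (sh Exp) (sm i)
  end.

(** Handling both kinds at once makes renamings, [subst] and the contractum of a multiplicative cut
    instances of one operation, so that the commutation lemmas are proved once. *)
Fixpoint inst_m (sm : nat -> mulval) (se : esubst) (v : mulval) : mulval :=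
  match v with
  | MVar m => sm m
  | MPair t s => MPair (inst sm se t) (inst sm se s)
  | MLam k t => MLam k (inst (upm k sm) (up_s k se) t)
  end
with inst_e (sm : nat -> mulval) (se : esubst) (v : expval) : expval :=
  match v with
  | EVar e => se e
  | EBang t => EBang (inst sm se t)
  end
with inst_v (sm : nat -> mulval) (se : esubst) (v : val) : val :=
  match v with
  | VM v => VM (inst_m sm se v)
  | VE v => VE (inst_e sm se v)
  end
with inst (sm : nat -> mulval) (se : esubst) (t : term) : term :=
  match t with
  | Val v => Val (inst_v sm se v)
  | Cut v k t => Cut (inst_v sm se v) k (inst (upm k sm) (up_s k se) t)
  | Par m kx ky t =>
      par_at (sm m) kx ky
        (inst (upm ky (upm kx sm)) (up_s ky (up_s kx se)) t)
  | Sub m v k t =>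
      sub_to (sm m) (inst_v sm se v) k (inst (upm k sm) (up_s k se) t)
  | Der e k t => der_at (se e) k (inst (upm k sm) (up_s k se) t)
  end.

Ltac subst_ext :=
  let i := fresh "i" in extensionality i;
  repeat match goal with k : kind |- _ => destruct k end;
  try (destruct i; [reflexivity|]);
  simpl; unfold rcomp, up; try reflexivity.

Lemma upm_MVar k : upm k MVar = MVar.
Proof. subst_ext. Qed.

Lemma upm_ren k r :
  upm k (fun i => MVar (r Mul i)) = fun i => MVar (up k r Mul i).
Proof. subst_ext. Qed.

Lemma up_s_ren k r :
  up_s k (fun i => EVar (r Exp i)) = fun i => EVar (up k r Exp i).
Proof. subst_ext. Qed.

Lemma upm_comp k sm r :
  upm k (fun i => sm (r Mul i)) = fun i => upm k sm (up k r Mul i).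
Proof. subst_ext. Qed.

Lemma up_s_comp k se r :
  up_s k (fun i => se (r Exp i)) = fun i => up_s k se (up k r Exp i).
Proof. subst_ext. Qed.

Lemma upm_ren_m k sm r :
  upm k (fun i => ren_m r (sm i)) = fun i => ren_m (up k r) (upm k sm i).
Proof.
  extensionality i; destruct k; [destruct i; [reflexivity|]|]; simpl;
  symmetry; apply ren_m_up_sh.
Qed.

Lemma up_s_ren_e k se r :
  up_s k (fun i => ren_e r (se i)) = fun i => ren_e (up k r) (up_s k se i).
Proof.
  extensionality i; destruct k; [|destruct i; [reflexivity|]]; simpl;
  symmetry; (apply (ren_e_up_sh Mul) || apply (ren_e_up_sh Exp)).
Qed.

Lemma inst_MVar_EVar_all :
  (forall v r, inst_m (fun i => MVar (r Mul i)) (fun i => EVar (r Exp i)) v = ren_m r v) /\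
  (forall v r, inst_e (fun i => MVar (r Mul i)) (fun i => EVar (r Exp i)) v = ren_e r v) /\
  (forall v r, inst_v (fun i => MVar (r Mul i)) (fun i => EVar (r Exp i)) v = ren_v r v) /\
  (forall t r, inst (fun i => MVar (r Mul i)) (fun i => EVar (r Exp i)) t = ren r t).
Proof.
  apply syntax_ind; simpl; intros; rewrite ?upm_ren, ?up_s_ren; f_equal; auto.
Qed.

Lemma inst_ren_all :
  (forall v sm se r, inst_m sm se (ren_m r v) =
     inst_m (fun i => sm (r Mul i)) (fun i => se (r Exp i)) v) /\
  (forall v sm se r, inst_e sm se (ren_e r v) =
     inst_e (fun i => sm (r Mul i)) (fun i => se (r Exp i)) v) /\
  (forall v sm se r, inst_v sm se (ren_v r v) =
     inst_v (fun i => sm (r Mul i)) (fun i => se (r Exp i)) v) /\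
  (forall t sm se r, inst sm se (ren r t) =
     inst (fun i => sm (r Mul i)) (fun i => se (r Exp i)) t).
Proof.
  apply syntax_ind; simpl; intros; rewrite ?upm_comp, ?up_s_comp; f_equal; auto.
Qed.

Lemma ren_inst_all :
  (forall v sm se r, ren_m r (inst_m sm se v) =
     inst_m (fun i => ren_m r (sm i)) (fun i => ren_e r (se i)) v) /\
  (forall v sm se r, ren_e r (inst_e sm se v) =
     inst_e (fun i => ren_m r (sm i)) (fun i => ren_e r (se i)) v) /\
  (forall v sm se r, ren_v r (inst_v sm se v) =
     inst_v (fun i => ren_m r (sm i)) (fun i => ren_e r (se i)) v) /\
  (forall t sm se r, ren r (inst sm se t) =
     inst (fun i => ren_m r (sm i)) (fun i => ren_e r (se i)) t).
Proof.
  apply syntax_ind; simpl; intros;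
  rewrite ?ren_par_at, ?ren_sub_to, ?ren_der_at, ?upm_ren_m, ?up_s_ren_e;
  f_equal; auto.
Qed.

Lemma inst_up_sh_all k sm se :
  (forall v, inst_m (upm k sm) (up_s k se) (ren_m (sh k) v) =
     ren_m (sh k) (inst_m sm se v)) /\
  (forall v, inst_e (upm k sm) (up_s k se) (ren_e (sh k) v) =
     ren_e (sh k) (inst_e sm se v)) /\
  (forall v, inst_v (upm k sm) (up_s k se) (ren_v (sh k) v) =
     ren_v (sh k) (inst_v sm se v)) /\
  (forall t, inst (upm k sm) (up_s k se) (ren (sh k) t) =
     ren (sh k) (inst sm se t)).
Proof.
  destruct inst_ren_all as (a & b & c & d);
  destruct ren_inst_all as (a' & b' & c' & d');
  repeat split; intros;
  rewrite ?a, ?b, ?c, ?d, ?a', ?b', ?c', ?d'; f_equal; extensionality i;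
  destruct k; reflexivity.
Qed.

Lemma inst_up_sh k sm se t :
  inst (upm k sm) (up_s k se) (ren (sh k) t) = ren (sh k) (inst sm se t).
Proof. apply inst_up_sh_all. Qed.

Lemma inst_v_up_sh k sm se v :
  inst_v (upm k sm) (up_s k se) (ren_v (sh k) v) = ren_v (sh k) (inst_v sm se v).
Proof. apply inst_up_sh_all. Qed.

Lemma inst_up_up_sh k k' sm se t :
  inst (upm k' (upm k sm)) (up_s k' (up_s k se)) (ren (up k' (sh k)) t) =
  ren (up k' (sh k)) (inst (upm k' sm) (up_s k' se) t).
Proof.
  destruct inst_ren_all as (_ & _ & _ & H);
  destruct ren_inst_all as (_ & _ & _ & H').
  rewrite H, H', <- upm_comp, <- up_s_comp, <- upm_ren_m, <- up_s_ren_e.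
  f_equal; f_equal; extensionality i; destruct k; reflexivity.
Qed.

(** Substitution may turn a par, sub or der in the spine of [s] into cuts. By [cut_at_par_at] and
    its two analogues this leaves the end of the spine in place, so the continuation [t] can still
    be attached there. *)
Lemma inst_cut_at s : forall sm se k t,
  inst sm se (cut_at s k t) =
  cut_at (inst sm se s) k (inst (upm k sm) (up_s k se) t).
Proof.
  induction s; intros; simpl; autorewrite with at_; simpl;
  rewrite ?cut_at_par_at, ?cut_at_sub_to, ?cut_at_der_at; f_equal;
  rewrite IHs, ?inst_up_up_sh; reflexivity.
Qed.

Lemma inst_par_at sm se w kx ky t :
  inst sm se (par_at w kx ky t) =
  par_at (inst_m sm se w) kx ky
    (inst (upm ky (upm kx sm)) (up_s ky (up_s kx se)) t).
Proof.
  destruct w; [reflexivity| |]; cbn [par_at inst_m];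
  rewrite !inst_cut_at, inst_up_sh; reflexivity.
Qed.

Lemma inst_sub_to sm se w v k t :
  inst sm se (sub_to w v k t) =
  sub_to (inst_m sm se w) (inst_v sm se v) k (inst (upm k sm) (up_s k se) t).
Proof.
  destruct w; [reflexivity| |]; unfold sub_to; fold inst_m;
  cbn [inst inst_m lkind]; f_equal;
  rewrite inst_cut_at, inst_up_up_sh; f_equal; unfold lbody;
  rewrite ?inst_up_sh; reflexivity.
Qed.

Lemma inst_der_at sm se w k t :
  inst sm se (der_at w k t) =
  der_at (inst_e sm se w) k (inst (upm k sm) (up_s k se) t).
Proof. destruct w; simpl; auto using inst_cut_at. Qed.

Lemma subst_inst_all :
  (forall v se, subst_m se v = inst_m MVar se v) /\
  (forall v se, subst_e se v = inst_e MVar se v) /\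
  (forall v se, subst_v se v = inst_v MVar se v) /\
  (forall t se, subst se t = inst MVar se t).
Proof.
  apply syntax_ind; simpl; intros; rewrite ?upm_MVar; try solve [f_equal; auto].
  destruct (se e); simpl; f_equal; auto.
Qed.

(** * Replacement of one occurrence *)

Definition var (K : kind) (i : nat) : val :=
  match K with Mul => VM (MVar i) | Exp => VE (EVar i) end.

(** [occ K i w t t'] : t' is t with one occurrence of the variable i of kind K
    replaced by, or fired against, the value w. *)
Inductive occ : kind -> nat -> val -> term -> term -> Prop :=
| occ_par i s u kx ky t :
    occ Mul i (VM (MPair s u)) (Par i kx ky t) (par_at (MPair s u) kx ky t)
| occ_sub i ky s v k t :
    occ Mul i (VM (MLam ky s)) (Sub i v k t) (sub_to (MLam ky s) v k t)
| occ_der i w k t :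
    occ Exp i (VE w) (Der i k t) (der_at w k t)
| occ_Val K i w v v' : occv K i w v v' -> occ K i w (Val v) (Val v')
| occ_CutL K i w v v' k t :
    occv K i w v v' -> occ K i w (Cut v k t) (Cut v' k t)
| occ_CutR K i w v k t t' :
    occ K (sh k K i) (ren_v (sh k) w) t t' -> occ K i w (Cut v k t) (Cut v k t')
| occ_ParR K i w m kx ky t t' :
    occ K (sh ky K (sh kx K i)) (ren_v (sh ky) (ren_v (sh kx) w)) t t' ->
    occ K i w (Par m kx ky t) (Par m kx ky t')
| occ_SubL K i w m v v' k t :
    occv K i w v v' -> occ K i w (Sub m v k t) (Sub m v' k t)
| occ_SubR K i w m v k t t' :
    occ K (sh k K i) (ren_v (sh k) w) t t' ->
    occ K i w (Sub m v k t) (Sub m v k t')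
| occ_DerR K i w e k t t' :
    occ K (sh k K i) (ren_v (sh k) w) t t' -> occ K i w (Der e k t) (Der e k t')
with occv : kind -> nat -> val -> val -> val -> Prop :=
| occv_var K i w : occv K i w (var K i) w
| occv_PairL K i w t t' s :
    occ K i w t t' -> occv K i w (VM (MPair t s)) (VM (MPair t' s))
| occv_PairR K i w t s s' :
    occ K i w s s' -> occv K i w (VM (MPair t s)) (VM (MPair t s'))
| occv_Lam K i w k t t' :
    occ K (sh k K i) (ren_v (sh k) w) t t' ->
    occv K i w (VM (MLam k t)) (VM (MLam k t'))
| occv_Bang i w t t' :
    occ Exp i w t t' -> occv Exp i w (VE (EBang t)) (VE (EBang t')).

#[local] Hint Constructors occ occv : core.

Scheme occ_mut := Induction for occ Sort Prop
with occv_mut := Induction for occv Sort Prop.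
Combined Scheme occ_occv_ind from occ_mut, occv_mut.

Lemma up_at_sh k r K i : up k r K (sh k K i) = sh k K (r K i).
Proof. destruct k, K; reflexivity. Qed.

Lemma ren_var K r i : ren_v r (var K i) = var K (r K i).
Proof. destruct K; reflexivity. Qed.

Lemma occ_ren_all :
  (forall K i w t t', occ K i w t t' -> forall r,
     occ K (r K i) (ren_v r w) (ren r t) (ren r t')) /\
  (forall K i w v v', occv K i w v v' -> forall r,
     occv K (r K i) (ren_v r w) (ren_v r v) (ren_v r v')).
Proof.
  apply occ_occv_ind; intros;
  rewrite ?ren_par_at, ?ren_sub_to, ?ren_der_at, ?ren_var; simpl; auto;
  constructor; auto;
  repeat match goal with H : forall r, occ _ (r _ ?j) _ _ _ |- occ _ _ _ (ren ?r _) _ =>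
    specialize (H r) end;
  rewrite ?up_at_sh, ?ren_v_up_sh in *; auto.
Qed.

Lemma occ_ren K i w t t' r :
  occ K i w t t' -> occ K (r K i) (ren_v r w) (ren r t) (ren r t').
Proof. intros; apply occ_ren_all; auto. Qed.

(** An occurrence in the spine stays in the spine, one in the head value becomes one in the value of
    the new cut. The second clause only feeds the mutual induction: values have no left context to
    commute. *)
Lemma occ_cut_atL_all :
  (forall K i w t t', occ K i w t t' -> forall k u,
     occ K i w (cut_at t k u) (cut_at t' k u)) /\
  (forall K i w v v', occv K i w v v' -> True).
Proof.
  apply occ_occv_ind; intros;
  rewrite ?cut_at_par_at, ?cut_at_sub_to, ?cut_at_der_at; autorewrite with at_;
  auto.
Qed.

Lemma occ_cut_atL K i w t t' k u :
  occ K i w t t' -> occ K i w (cut_at t k u) (cut_at t' k u).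
Proof. intros; apply occ_cut_atL_all; auto. Qed.

Lemma occ_ren_up_sh K i w k k' t t' :
  occ K (sh k K i) (ren_v (sh k) w) t t' ->
  occ K (sh k K (sh k' K i)) (ren_v (sh k) (ren_v (sh k') w))
    (ren (up k (sh k')) t) (ren (up k (sh k')) t').
Proof.
  intros H; apply (occ_ren _ _ _ _ _ (up k (sh k'))) in H.
  rewrite up_at_sh, ren_v_up_sh in H; exact H.
Qed.

Lemma occ_cut_atR s : forall K i w k t t',
  occ K (sh k K i) (ren_v (sh k) w) t t' ->
  occ K i w (cut_at s k t) (cut_at s k t').
Proof.
  induction s; intros; autorewrite with at_; auto;
  constructor; apply IHs; auto using occ_ren_up_sh.
Qed.

Lemma occ_par_atR u K i w kx ky t t' :
  occ K (sh ky K (sh kx K i)) (ren_v (sh ky) (ren_v (sh kx) w)) t t' ->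
  occ K i w (par_at u kx ky t) (par_at u kx ky t').
Proof.
  intros; destruct u; unfold par_at; auto; do 2 apply occ_cut_atR; auto.
Qed.

Lemma occ_sub_toL u K i w v v' k t :
  occv K i w v v' -> occ K i w (sub_to u v k t) (sub_to u v' k t).
Proof. intros; destruct u; unfold sub_to; auto. Qed.

Lemma occ_sub_toR u K i w v k t t' :
  occ K (sh k K i) (ren_v (sh k) w) t t' ->
  occ K i w (sub_to u v k t) (sub_to u v k t').
Proof.
  intros; destruct u; unfold sub_to; auto; constructor; apply occ_cut_atR;
  auto using occ_ren_up_sh.
Qed.

Lemma occ_der_atR u K i w k t t' :
  occ K (sh k K i) (ren_v (sh k) w) t t' ->
  occ K i w (der_at u k t) (der_at u k t').
Proof. intros; destruct u; simpl; auto using occ_cut_atR. Qed.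

Lemma sub_at_par_at m w kx ky s k t :
  sub_at m (par_at w kx ky s) k t =
  par_at w kx ky
    (sub_at (sh ky Mul (sh kx Mul m)) s k (ren (up k (sh ky)) (ren (up k (sh kx)) t))).
Proof.
  destruct w; unfold par_at; autorewrite with at_; auto;
  rewrite !sub_at_cut_at; reflexivity.
Qed.

Lemma sub_at_sub_to m w v k' s k t :
  sub_at m (sub_to w v k' s) k t =
  sub_to w v k' (sub_at (sh k' Mul m) s k (ren (up k (sh k')) t)).
Proof.
  destruct w; unfold sub_to; autorewrite with at_; auto; f_equal;
  rewrite sub_at_cut_at, ren_sub_at, ren_up_up_sh; f_equal; f_equal;
  destruct k'; try reflexivity; simpl; try destruct k0; reflexivity.
Qed.

Lemma sub_at_der_at m w k' s k t :
  sub_at m (der_at w k' s) k t =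
  der_at w k' (sub_at (sh k' Mul m) s k (ren (up k (sh k')) t)).
Proof.
  destruct w; unfold der_at; autorewrite with at_; auto using sub_at_cut_at.
Qed.

Lemma occ_sub_atL_all :
  (forall K i w t t', occ K i w t t' -> forall m k u,
     occ K i w (sub_at m t k u) (sub_at m t' k u)) /\
  (forall K i w v v', occv K i w v v' -> True).
Proof.
  apply occ_occv_ind; intros;
  rewrite ?sub_at_par_at, ?sub_at_sub_to, ?sub_at_der_at; autorewrite with at_;
  auto.
Qed.

Definition sgv (sm : nat -> mulval) (se : esubst) (K : kind) (i : nat) : val :=
  match K with Mul => VM (sm i) | Exp => VE (se i) end.

Lemma sgv_up k sm se K i :
  sgv (upm k sm) (up_s k se) K (sh k K i) = ren_v (sh k) (sgv sm se K i).
Proof. destruct k, K; reflexivity. Qed.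

Lemma inst_var sm se K i : inst_v sm se (var K i) = sgv sm se K i.
Proof. destruct K; reflexivity. Qed.

(** If the substitution sends the variable to the image of [w] anyway, performing this early at one
    occurrence makes no difference: [inst] commutes with [par_at], [sub_to] and [der_at]. *)
Lemma occ_inst_eq_all :
  (forall K i w t t', occ K i w t t' -> forall sm se,
     sgv sm se K i = inst_v sm se w -> inst sm se t = inst sm se t') /\
  (forall K i w v v', occv K i w v v' -> forall sm se,
     sgv sm se K i = inst_v sm se w -> inst_v sm se v = inst_v sm se v').
Proof.
  apply occ_occv_ind; intros;
  rewrite ?inst_par_at, ?inst_sub_to, ?inst_der_at, ?inst_var;
  cbn [inst inst_m inst_e inst_v sgv] in *;
  try congruence;
  match goal with H : forall (sm : nat -> mulval) se, _ -> _ |- _ =>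
    erewrite H; [reflexivity|] end;
  rewrite ?sgv_up, ?inst_v_up_sh; congruence.
Qed.

Lemma occ_inst_eq K i w t t' sm se :
  occ K i w t t' -> sgv sm se K i = inst_v sm se w -> inst sm se t = inst sm se t'.
Proof. intros; eapply occ_inst_eq_all; eauto. Qed.

(** A variable that is merely renamed still has its occurrences after the substitution. This keeps a
    redex a redex inside an instance, where its bound variable is mapped to itself. *)
Lemma occ_inst_all :
  (forall K i w t t', occ K i w t t' -> forall sm se j,
     sgv sm se K i = var K j ->
     occ K j (inst_v sm se w) (inst sm se t) (inst sm se t')) /\
  (forall K i w v v', occv K i w v v' -> forall sm se j,
     sgv sm se K i = var K j ->
     occv K j (inst_v sm se w) (inst_v sm se v) (inst_v sm se v')).
Proof.
  assert (E : forall k sm se K i j, sgv sm se K i = var K j ->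
    sgv (upm k sm) (up_s k se) K (sh k K i) = var K (sh k K j)).
  { intros; rewrite sgv_up, H, ren_var; reflexivity. }
  apply occ_occv_ind; intros;
  rewrite ?inst_par_at, ?inst_sub_to, ?inst_der_at;
  cbn [inst inst_m inst_e inst_v];
  try (match goal with H : sgv _ _ _ _ = _ |- _ =>
      cbn in H; injection H; intros -> end;
    constructor; fail); auto.
  - apply occ_CutR; rewrite <- inst_v_up_sh; auto.
  - apply occ_par_atR; rewrite <- !inst_v_up_sh; auto.
  - apply occ_sub_toL; auto.
  - apply occ_sub_toR; rewrite <- inst_v_up_sh; auto.
  - apply occ_der_atR; rewrite <- inst_v_up_sh; auto.
  - rewrite inst_var, H; auto.
  - constructor; rewrite <- inst_v_up_sh; auto.
Qed.

Lemma occ_sub_atL K i w t t' m k u :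
  occ K i w t t' -> occ K i w (sub_at m t k u) (sub_at m t' k u).
Proof. intros; apply occ_sub_atL_all; auto. Qed.

Lemma occ_inst K i w t t' sm se j :
  occ K i w t t' -> sgv sm se K i = var K j ->
  occ K j (inst_v sm se w) (inst sm se t) (inst sm se t').
Proof. intros; eapply occ_inst_all; eauto. Qed.

(** * Weighted counting of occurrences *)

(** The ways in which a variable can occur: a multiplicative one as a value or
    as the subject of a par or sub, an exponential one in any way. *)
Inductive role := RVar | RPar | RSub | RExp.

Definition rkind (ro : role) : kind := match ro with RExp => Exp | _ => Mul end.

Definition weight := role -> nat -> nat.

Definition upw (k : kind) (g : weight) : weight := fun ro i =>
  match k, rkind ro with
  | Mul, Mul | Exp, Exp => match i with 0 => 0 | S j => g ro j end
  | _, _ => g ro i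
  end.

Fixpoint wt_m (g : weight) (v : mulval) : nat :=
  match v with
  | MVar m => g RVar m
  | MPair t s => wt g t + wt g s
  | MLam k t => wt (upw k g) t
  end
with wt_e (g : weight) (v : expval) : nat :=
  match v with
  | EVar e => g RExp e
  | EBang t => wt g t
  end
with wt_v (g : weight) (v : val) : nat :=
  match v with
  | VM v => wt_m g v
  | VE v => wt_e g v
  end
with wt (g : weight) (t : term) : nat :=
  match t with
  | Val v => wt_v g v
  | Cut v k t => wt_v g v + wt (upw k g) t
  | Par m kx ky t => g RPar m + wt (upw ky (upw kx g)) t
  | Sub m v k t => g RSub m + wt_v g v + wt (upw k g) t
  | Der e k t => g RExp e + wt (upw k g) t
  end.

Definition occs (i : nat) : weight := fun ro j =>
  match rkind ro with Mul => same i j | Exp => 0 end.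
Definition wren (r : renaming) (g : weight) : weight := fun ro i =>
  g ro (r (rkind ro) i).

Ltac weight_ext :=
  let ro := fresh "ro" in let i := fresh "i" in
  extensionality ro; extensionality i;
  repeat match goal with j : kind |- _ => destruct j end; destruct ro;
  try reflexivity; destruct i; reflexivity.

Lemma upw_occs k i : upw k (occs i) = occs (mup k i).
Proof. weight_ext. Qed.

Lemma upw_wren k r g : upw k (wren r g) = wren (up k r) (upw k g).
Proof. weight_ext. Qed.

Lemma wren_sh k g : wren (sh k) (upw k g) = g.
Proof. weight_ext. Qed.

Lemma wren_up_sh k k' g : wren (up k' (sh k)) (upw k' (upw k g)) = upw k' g.
Proof. weight_ext. Qed.

Lemma mocc_wt_all :
  (forall v i, mocc_m i v = wt_m (occs i) v) /\
  (forall v i, mocc_e i v = wt_e (occs i) v) /\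
  (forall v i, mocc_v i v = wt_v (occs i) v) /\
  (forall t i, mocc i t = wt (occs i) t).
Proof.
  apply syntax_ind; simpl; intros; rewrite ?upw_occs; auto.
Qed.

Lemma mocc_wt i t : mocc i t = wt (occs i) t.
Proof. apply mocc_wt_all. Qed.
Lemma mocc_v_wt i t : mocc_v i t = wt_v (occs i) t.
Proof. apply mocc_wt_all. Qed.

Lemma wt_ren_all :
  (forall v g r, wt_m g (ren_m r v) = wt_m (wren r g) v) /\
  (forall v g r, wt_e g (ren_e r v) = wt_e (wren r g) v) /\
  (forall v g r, wt_v g (ren_v r v) = wt_v (wren r g) v) /\
  (forall t g r, wt g (ren r t) = wt (wren r g) t).
Proof.
  apply syntax_ind; simpl; intros; rewrite ?upw_wren; try reflexivity; auto.
Qed.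

Lemma wt_ren t g r : wt g (ren r t) = wt (wren r g) t.
Proof. apply wt_ren_all. Qed.
Lemma wt_v_ren t g r : wt_v g (ren_v r t) = wt_v (wren r g) t.
Proof. apply wt_ren_all. Qed.
Lemma wt_m_ren t g r : wt_m g (ren_m r t) = wt_m (wren r g) t.
Proof. apply wt_ren_all. Qed.

Lemma wt_le_all :
  (forall v g g', (forall ro i, g ro i <= g' ro i) -> wt_m g v <= wt_m g' v) /\
  (forall v g g', (forall ro i, g ro i <= g' ro i) -> wt_e g v <= wt_e g' v) /\
  (forall v g g', (forall ro i, g ro i <= g' ro i) -> wt_v g v <= wt_v g' v) /\
  (forall t g g', (forall ro i, g ro i <= g' ro i) -> wt g t <= wt g' t).
Proof.
  assert (U : forall k g g', (forall ro i, g ro i <= g' ro i) ->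
    forall ro i, upw k g ro i <= upw k g' ro i).
  { intros [] g g' H [] [|i]; simpl; auto. }
  apply syntax_ind; simpl; intros; auto; repeat apply Nat.add_le_mono; eauto.
Qed.

Lemma wt_add_all :
  (forall v g g', wt_m (fun ro i => g ro i + g' ro i) v = wt_m g v + wt_m g' v) /\
  (forall v g g', wt_e (fun ro i => g ro i + g' ro i) v = wt_e g v + wt_e g' v) /\
  (forall v g g', wt_v (fun ro i => g ro i + g' ro i) v = wt_v g v + wt_v g' v) /\
  (forall t g g', wt (fun ro i => g ro i + g' ro i) t = wt g t + wt g' t).
Proof.
  assert (U : forall k g g', upw k (fun ro i => g ro i + g' ro i) =
    fun ro i => upw k g ro i + upw k g' ro i).
  { intros; weight_ext. }
  apply syntax_ind; simpl; intros; rewrite ?U;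
  repeat match goal with H : context [_ = _ + _] |- _ => rewrite H; clear H end; lia.
Qed.

Lemma upw_RExp k g : (forall i, g RExp i = 0) -> forall i, upw k g RExp i = 0.
Proof. intros H i; destruct k; [|destruct i]; simpl; auto. Qed.

(** The disjunction is stated per variable in order to pass under binders: a bound multiplicative
    variable may occur, but [upw] gives it weight 0. *)
Lemma wt_0_all :
  (forall v g, (forall i, g RExp i = 0) ->
     (forall i, mocc_m i v = 0 \/ forall ro, g ro i = 0) -> wt_m g v = 0) /\
  (forall v g, (forall i, g RExp i = 0) ->
     (forall i, mocc_e i v = 0 \/ forall ro, g ro i = 0) -> wt_e g v = 0) /\
  (forall v g, (forall i, g RExp i = 0) ->
     (forall i, mocc_v i v = 0 \/ forall ro, g ro i = 0) -> wt_v g v = 0) /\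
  (forall t g, (forall i, g RExp i = 0) ->
     (forall i, mocc i t = 0 \/ forall ro, g ro i = 0) -> wt g t = 0).
Proof.
  pose proof upw_RExp as X.
  assert (U : forall k g (f : nat -> nat), (forall i, g RExp i = 0) ->
    (forall i, f (mup k i) = 0 \/ forall ro, g ro i = 0) ->
    forall i, f i = 0 \/ forall ro, upw k g ro i = 0).
  { intros [] g f Z H i; [destruct i|].
    - right; intros []; simpl; auto.
    - destruct (H i) as [E|E]; auto; right; intros []; simpl; auto.
    - destruct (H i) as [E|E]; auto; right; intros []; simpl; auto.
      destruct i; auto. }
  assert (D : forall i, same i i <> 0).
  { intros i; unfold same; rewrite Nat.eqb_refl; lia. }
  assert (V : forall (g : weight) m (f : nat -> nat),
    (forall i, same i m + f i = 0 \/ forall ro, g ro i = 0) ->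
    forall ro, g ro m = 0).
  { intros g m f H; destruct (H m) as [E|E]; auto; specialize (D m); lia. }
  apply syntax_ind; simpl; intros; auto.
  - apply (V g m (fun _ => 0)); intros i; rewrite Nat.add_0_r; auto.
  - rewrite H, H0; auto; intros j; destruct (H2 j); auto; left; lia.
  - apply H; auto; apply U; auto.
  - rewrite H, H0; auto; [apply U; auto|]; intros j; destruct (H2 j); auto; left; lia.
  - rewrite (V g m _ H1), H; auto; apply U; auto.
    apply (U _ _ (fun i => mocc (mup ky i) t)); auto.
    intros j; destruct (H1 j); auto; left; lia.
  - rewrite (V g m (fun i => mocc_v i v + mocc (mup k i) t)), H, H0; auto.
    + apply U; auto; intros j; destruct (H2 j); auto; left; lia.
    + intros j; destruct (H2 j); auto; left; lia.
    + intros j; rewrite Nat.add_assoc; auto.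
  - rewrite H0, H; auto; apply U; auto.
Qed.

Lemma wt_0 t g : (forall i, g RExp i = 0) -> (forall i, mocc i t = 0) -> wt g t = 0.
Proof. intros; apply wt_0_all; auto. Qed.

Lemma wt_cut_at s : forall g k t, wt g (cut_at s k t) = wt g s + wt (upw k g) t.
Proof.
  induction s; intros; autorewrite with at_; simpl; auto;
  rewrite IHs, ?wt_ren, ?wren_up_sh; lia.
Qed.

(** The untyped dead ends, where no multiplicative rule applies. Variables never clash: they just
    rename the subject. *)
Definition clash (ro : role) (w : mulval) : nat :=
  match ro, w with RPar, MLam _ _ | RSub, MPair _ _ => 1 | _, _ => 0 end.

Lemma clash_ren ro r w : clash ro (ren_m r w) = clash ro w.
Proof. destruct ro, w; reflexivity. Qed.

Definition clash_v (ro : role) (w : val) : nat :=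
  match w with VM w => clash ro w | VE _ => 0 end.

Lemma clash_v_ren ro r w : clash_v ro (ren_v r w) = clash_v ro w.
Proof. destruct w; simpl; auto using clash_ren. Qed.

Lemma upw_sh k g ro i : upw k g ro (sh k (rkind ro) i) = g ro i.
Proof. destruct k, ro; reflexivity. Qed.

(** One occurrence, in the role [ro], is traded for one copy of [w]. As [ro] is chosen before [g], a
    single identity serves for counting variables ([occs]), for detecting clashes ([cw]) and for
    measuring the exponential occurrences left ([eoccs0]). *)
Lemma occ_wt_all :
  (forall K i w t t', occ K i w t t' -> exists ro,
     rkind ro = K /\ clash_v ro w = 0 /\
     forall g, wt g t' + g ro i = wt g t + wt_v g w) /\
  (forall K i w v v', occv K i w v v' -> exists ro,
     rkind ro = K /\ clash_v ro w = 0 /\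
     forall g, wt_v g v' + g ro i = wt_v g v + wt_v g w).
Proof.
  apply occ_occv_ind; intros; cbn [wt wt_m wt_e wt_v];
  try match goal with
  | H : exists ro, _ |- _ => destruct H as (ro & <- & C & E);
     rewrite ?clash_v_ren in C; exists ro; repeat split; auto; intros g
  end;
  try (specialize (E g); lia);
  try (specialize (E (upw k g)); rewrite wt_v_ren, wren_sh, upw_sh in E; lia).
  - exists RPar; repeat split; intros g; unfold par_at; cbn [pfst psnd];
    rewrite !wt_cut_at, wt_ren, wren_sh; lia.
  - exists RSub; repeat split; intros g; unfold sub_to; cbn [lkind lbody wt];
    rewrite !wt_cut_at, wt_ren, wren_up_sh; lia.
  - exists RExp; repeat split; intros g; destruct w; simpl; rewrite ?wt_cut_at; lia.
  - specialize (E (upw ky (upw kx g))).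
    rewrite wt_v_ren, wren_sh, wt_v_ren, wren_sh, !upw_sh in E; lia.
  - destruct K; [exists RVar|exists RExp]; repeat split; try (intros; simpl; lia);
    destruct w as [[]|]; reflexivity.
Qed.

Lemma occ_wt K i w t t' : occ K i w t t' -> exists ro,
  rkind ro = K /\ clash_v ro w = 0 /\
  forall g, wt g t' + g ro i = wt g t + wt_v g w.
Proof. apply occ_wt_all. Qed.

(** * Proper terms *)

Lemma mocc_cut_at i s k t : mocc i (cut_at s k t) = mocc i s + mocc (mup k i) t.
Proof. rewrite !mocc_wt, wt_cut_at, upw_occs; reflexivity. Qed.

Lemma mocc_ren_sh k i t : mocc (mup k i) (ren (sh k) t) = mocc i t.
Proof. rewrite !mocc_wt, wt_ren, <- upw_occs, wren_sh; reflexivity. Qed.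

Lemma mocc_v_ren_sh k i v : mocc_v (mup k i) (ren_v (sh k) v) = mocc_v i v.
Proof. rewrite !mocc_v_wt, wt_v_ren, <- upw_occs, wren_sh; reflexivity. Qed.

Lemma mocc_ren_up_sh k k' i t :
  mocc (mup k (mup k' i)) (ren (up k (sh k')) t) = mocc (mup k i) t.
Proof. rewrite !mocc_wt, wt_ren, <- !upw_occs, wren_up_sh; reflexivity. Qed.

Lemma wt_null t g : (forall ro i, g ro i = 0) -> wt g t = 0.
Proof. intros; apply wt_0_all; auto. Qed.

Lemma mocc_ren_up_sh0 k t : mocc (mup k 0) (ren (up k (sh Mul)) t) = 0.
Proof.
  rewrite mocc_wt, wt_ren; apply wt_null; intros ro i.
  destruct k, ro; try reflexivity; destruct i; reflexivity.
Qed.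

Lemma mocc_ren_sh0 t : mocc 0 (ren (sh Mul) t) = 0.
Proof. rewrite mocc_wt, wt_ren; apply wt_null; intros []; reflexivity. Qed.

Lemma mocc_v_ren_sh0 v : mocc_v 0 (ren_v (sh Mul) v) = 0.
Proof. rewrite mocc_v_wt, wt_v_ren; apply wt_0_all; auto; right; intros []; auto. Qed.

Lemma at_most_once_le k i i' t t' :
  (k = Mul -> mocc i t' <= mocc i' t) -> at_most_once k i' t -> at_most_once k i t'.
Proof. destruct k; simpl; auto; intros H ?; specialize (H eq_refl); lia. Qed.

Lemma mocc_ren_eq i r t :
  wren r (occs i) = occs i -> mocc i (ren r t) = mocc i t.
Proof. intros E; rewrite !mocc_wt, wt_ren, E; reflexivity. Qed.

Lemma mocc_ren_le i r t : mocc i t <= mocc (r Mul i) (ren r t).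
Proof.
  rewrite !mocc_wt, wt_ren; apply wt_le_all; intros ro j.
  destruct ro; unfold wren, occs, same; simpl; auto;
  (destruct (Nat.eqb_spec i j); [subst; rewrite Nat.eqb_refl|]; lia).
Qed.

(** A renaming may identify free variables, but [proper] restricts these only under a bang, where no
    multiplicative one occurs; bound variables are not affected. The converse direction recovers
    properness of a contractum from its shifted form. *)
Lemma proper_ren_all :
  (forall v r, proper_m (ren_m r v) <-> proper_m v) /\
  (forall v r, proper_e (ren_e r v) <-> proper_e v) /\
  (forall v r, proper_v (ren_v r v) <-> proper_v v) /\
  (forall t r, proper (ren r t) <-> proper t).
Proof.
  assert (A : forall k r t, at_most_once k 0 (ren (up k r) t) <-> at_most_once k 0 t).
  { intros [] r t; simpl; [|tauto]; rewrite mocc_ren_eq; [tauto|weight_ext]. }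
  assert (B : forall k k' r t, at_most_once k (mup k' 0) (ren (up k' (up k r)) t) <->
     at_most_once k (mup k' 0) t).
  { intros [] k' r t; simpl; [|tauto]; rewrite mocc_ren_eq; [tauto|].
    extensionality ro; extensionality i; destruct k', ro; try reflexivity;
    do 2 (destruct i; try reflexivity). }
  apply syntax_ind; simpl; intros; rewrite ?A, ?B;
  repeat match goal with
    H : forall r, ?p (_ r ?t) <-> _ |- context [?p (_ ?r' ?t)] => rewrite (H r') end;
  try tauto.
  split; intros [C P]; split; auto; intros i.
  - specialize (C (r Mul i)); pose proof (mocc_ren_le i r t); lia.
  - rewrite mocc_wt, wt_ren; auto using wt_0.
Qed.

Lemma proper_ren t r : proper (ren r t) <-> proper t.
Proof. apply proper_ren_all. Qed.
Lemma proper_v_ren t r : proper_v (ren_v r t) <-> proper_v t.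
Proof. apply proper_ren_all. Qed.

Lemma proper_cut_at s : forall k t,
  proper s -> at_most_once k 0 t -> proper t -> proper (cut_at s k t).
Proof.
  assert (A : forall k' s k t, at_most_once k' 0 s ->
    at_most_once k' 0 (cut_at s k (ren (up k (sh k')) t))).
  { intros k' s' k t; apply at_most_once_le; intros ->.
    rewrite mocc_cut_at, mocc_ren_up_sh0; lia. }
  assert (B : forall k' k t, at_most_once k 0 t ->
    at_most_once k 0 (ren (up k (sh k')) t)).
  { intros k' k t; apply at_most_once_le; intros ->.
    rewrite mocc_ren_eq; [lia|weight_ext]. }
  induction s; intros k' u; autorewrite with at_; simpl; intros;
  repeat match goal with H : _ /\ _ |- _ => destruct H end;
  repeat split; auto;
  try (apply IHs; auto; rewrite ?proper_ren; auto).
  eapply at_most_once_le; [intros ->|eassumption].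
  rewrite mocc_cut_at, mocc_ren_up_sh, mocc_ren_up_sh0; lia.
Qed.

Lemma occ_mocc_le i K j w t t' : occ K j w t t' -> mocc i t' <= mocc i t + mocc_v i w.
Proof.
  intros H; destruct (occ_wt _ _ _ _ _ H) as (ro & _ & _ & E).
  specialize (E (occs i)); rewrite !mocc_wt, mocc_v_wt; lia.
Qed.

(** An exponential replacement may land under a bang, so [w] must then be free of multiplicative
    variables. A multiplicative one never does, since [occv_Bang] is restricted to [Exp]. *)
Lemma occ_proper_all :
  (forall K i w t t', occ K i w t t' ->
     (K = Exp -> forall j, mocc_v j w = 0) -> proper_v w -> proper t -> proper t') /\
  (forall K i w v v', occv K i w v v' ->
     (K = Exp -> forall j, mocc_v j w = 0) -> proper_v w -> proper_v v -> proper_v v').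
Proof.
  assert (Z : forall k w, (forall j, mocc_v j w = 0) ->
     forall j, mocc_v j (ren_v (sh k) w) = 0).
  { intros k w H j; rewrite mocc_v_wt, wt_v_ren; apply wt_0_all; auto. }
  assert (A : forall K i k w t t', occ K i (ren_v (sh k) w) t t' ->
    at_most_once k 0 t -> at_most_once k 0 t').
  { intros K i k w t t' H; apply at_most_once_le; intros ->.
    apply (occ_mocc_le 0) in H; rewrite mocc_v_ren_sh0 in H; lia. }
  apply occ_occv_ind; cbn [proper proper_v proper_m proper_e]; intros;
  repeat match goal with H : _ /\ _ |- _ => destruct H end;
  repeat split; eauto;
  try match goal with H : _ -> _ -> proper ?t -> proper ?t' |- proper ?t' =>
    apply H; rewrite ?proper_v_ren; auto end.
  - unfold par_at; cbn [pfst psnd]; apply proper_cut_at; auto.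
    + eapply at_most_once_le; [intros ->|eassumption].
      rewrite mocc_cut_at, mocc_ren_sh0; lia.
    + apply proper_cut_at; auto; apply proper_ren; auto.
  - cbn [lkind lbody]; eapply at_most_once_le; [intros ->|eassumption].
    rewrite mocc_cut_at, mocc_ren_up_sh0; lia.
  - cbn [lkind lbody]; apply proper_cut_at; rewrite ?proper_ren; auto.
    eapply at_most_once_le; [intros ->|eassumption].
    rewrite mocc_ren_eq; [lia|weight_ext].
  - destruct w; simpl in *; auto.
    destruct H0; apply proper_cut_at; auto.
  - eapply at_most_once_le; [intros ->|eassumption].
    apply (occ_mocc_le (mup ky 0)) in o.
    rewrite mocc_v_ren_sh, mocc_v_ren_sh0 in o; lia.
  - intros j. apply (occ_mocc_le j) in o. rewrite H0, H2 in o; auto; lia.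
Qed.

Lemma occ_proper K i w t t' :
  occ K i w t t' -> (K = Exp -> forall j, mocc_v j w = 0) ->
  proper_v w -> proper t -> proper t'.
Proof. apply occ_proper_all. Qed.

Lemma proper_e_wt v g : (forall i, g RExp i = 0) -> proper_e v -> wt_e g v = 0.
Proof. destruct v; simpl; auto; intros Z []; apply wt_0; auto. Qed.

Lemma proper_up_s k se :
  (forall i, proper_e (se i)) -> forall i, proper_e (up_s k se i).
Proof.
  intros H i; destruct k; [|destruct i]; simpl; auto;
  apply proper_ren_all; auto.
Qed.
#[local] Hint Resolve proper_up_s : core.

(** Proper exponential values have no free multiplicative variables, so the copies made by the
    substitution weigh nothing once exponential occurrences do. *)
Lemma wt_subst_all :
  (forall v se g, (forall i, g RExp i = 0) -> (forall i, proper_e (se i)) ->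
     wt_m g (subst_m se v) = wt_m g v) /\
  (forall v se g, (forall i, g RExp i = 0) -> (forall i, proper_e (se i)) ->
     wt_e g (subst_e se v) = wt_e g v) /\
  (forall v se g, (forall i, g RExp i = 0) -> (forall i, proper_e (se i)) ->
     wt_v g (subst_v se v) = wt_v g v) /\
  (forall t se g, (forall i, g RExp i = 0) -> (forall i, proper_e (se i)) ->
     wt g (subst se t) = wt g t).
Proof.
  apply syntax_ind; simpl; intros; auto 6 using upw_RExp.
  - rewrite H; auto using proper_e_wt.
  - rewrite H0; destruct (se e) eqn:E; simpl; [rewrite H0, H; auto using upw_RExp|].
    pose proof (H1 e) as P; rewrite E in P; destruct P.
    rewrite wt_cut_at, wt_0, H; auto using upw_RExp.
Qed.

Lemma mocc_subst se t i : (forall i, proper_e (se i)) -> mocc i (subst se t) = mocc i t.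
Proof. intros; rewrite !mocc_wt; apply wt_subst_all; auto. Qed.

Lemma proper_subst_all :
  (forall v se, (forall i, proper_e (se i)) -> proper_m v -> proper_m (subst_m se v)) /\
  (forall v se, (forall i, proper_e (se i)) -> proper_e v -> proper_e (subst_e se v)) /\
  (forall v se, (forall i, proper_e (se i)) -> proper_v v -> proper_v (subst_v se v)) /\
  (forall t se, (forall i, proper_e (se i)) -> proper t -> proper (subst se t)).
Proof.
  assert (A : forall k i t se, (forall i, proper_e (se i)) ->
    at_most_once k i t -> at_most_once k i (subst se t)).
  { intros k i t se H; apply at_most_once_le; rewrite mocc_subst; auto. }
  apply syntax_ind; simpl; intros;
  repeat match goal with H : _ /\ _ |- _ => destruct H end;
  repeat split; auto; try (apply A; auto; fail).
  - intros; rewrite mocc_subst; auto.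
  - pose proof (H0 e) as P; destruct (se e); simpl in *.
    + split; auto.
    + destruct P; apply proper_cut_at; auto.
Qed.

Lemma proper_subst t se :
  (forall i, proper_e (se i)) -> proper t -> proper (subst se t).
Proof. apply proper_subst_all. Qed.

(** * A linear occurrence can be fired *)

(** [wt (cw sm) t = 0] says that no variable of t clashes with its image. *)
Definition cw (sm : nat -> mulval) : weight := fun ro i => clash ro (sm i).

Lemma upw_cw k sm : upw k (cw sm) = cw (upm k sm).
Proof.
  extensionality ro; extensionality i; unfold upw, cw.
  destruct k, i; cbn [upm]; rewrite ?clash_ren; destruct ro; reflexivity.
Qed.

Definition is_mvar (w : mulval) : Prop := exists n, w = MVar n.

Lemma is_mvar_ren r w : is_mvar (ren_m r w) <-> is_mvar w.
Proof. unfold is_mvar; destruct w; split; intros [n E]; try discriminate; simpl; eauto. Qed.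

(** The two ends of one firing: [sm] still keeps the linear variable as [j], while [sm'] has already
    replaced it by [w]. *)
Definition upd (i j : nat) (w : mulval) (sm sm' : nat -> mulval) : Prop :=
  (forall i', i' <> i -> sm i' = sm' i') /\ sm i = MVar j /\ sm' i = w.

Lemma upd_up k i j w sm sm' :
  upd i j w sm sm' ->
  upd (mup k i) (sh k Mul j) (ren_m (sh k) w) (upm k sm) (upm k sm').
Proof.
  intros (A & B & C); destruct k; (split; [|split; cbn; rewrite ?B, ?C; auto]).
  - intros [|i'] H; simpl; auto; rewrite A; auto.
  - intros i' H; simpl; rewrite A; auto.
Qed.
#[local] Hint Resolve upd_up : core.

Lemma same_0 i j : same i j = 0 -> j <> i.
Proof. unfold same; destruct (Nat.eqb_spec i j); auto; discriminate. Qed.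

Lemma inst_agree_all :
  (forall v sm sm' se i j w, upd i j w sm sm' -> mocc_m i v = 0 ->
     inst_m sm se v = inst_m sm' se v) /\
  (forall v sm sm' se i j w, upd i j w sm sm' -> mocc_e i v = 0 ->
     inst_e sm se v = inst_e sm' se v) /\
  (forall v sm sm' se i j w, upd i j w sm sm' -> mocc_v i v = 0 ->
     inst_v sm se v = inst_v sm' se v) /\
  (forall t sm sm' se i j w, upd i j w sm sm' -> mocc i t = 0 ->
     inst sm se t = inst sm' se t).
Proof.
  apply syntax_ind; simpl; intros;
  repeat match goal with H : _ + _ = 0 |- _ => apply Nat.eq_add_0 in H; destruct H end;
  try match goal with U : upd ?i _ _ _ _, H : same ?i ?m = 0 |- _ =>
    apply same_0 in H; apply (proj1 U) in H; rewrite H end;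
  f_equal; eauto.
Qed.

Ltac split_one := match goal with H : _ + _ = 1 |- _ =>
  apply Nat.eq_add_1 in H; destruct H as [[? ?]|[? ?]] end.

(** With a single occurrence of [i], the two instances agree on all subterms that avoid it, so they
    differ by one replacement. The hypotheses exclude what multiplicative [occ] cannot express: a
    par or sub meeting a variable or a clashing value, and an occurrence under a bang. *)
Lemma upd_occ_all :
  (forall v sm sm' se i j w, upd i j w sm sm' -> ~ is_mvar w -> proper_m v ->
     wt_m (cw sm') v = 0 -> mocc_m i v = 1 ->
     occv Mul j (VM w) (VM (inst_m sm se v)) (VM (inst_m sm' se v))) /\
  (forall v sm sm' se i j w, upd i j w sm sm' -> ~ is_mvar w -> proper_e v ->
     wt_e (cw sm') v = 0 -> mocc_e i v = 1 ->
     occv Mul j (VM w) (VE (inst_e sm se v)) (VE (inst_e sm' se v))) /\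
  (forall v sm sm' se i j w, upd i j w sm sm' -> ~ is_mvar w -> proper_v v ->
     wt_v (cw sm') v = 0 -> mocc_v i v = 1 ->
     occv Mul j (VM w) (inst_v sm se v) (inst_v sm' se v)) /\
  (forall t sm sm' se i j w, upd i j w sm sm' -> ~ is_mvar w -> proper t ->
     wt (cw sm') t = 0 -> mocc i t = 1 ->
     occ Mul j (VM w) (inst sm se t) (inst sm' se t)).
Proof.
  destruct inst_agree_all as (Am & Ae & Av & At).
  assert (N : forall k w, ~ is_mvar w -> ~ is_mvar (ren_m (sh k) w)).
  { intros; rewrite is_mvar_ren; auto. }
  assert (E : forall i j w sm sm' m, upd i j w sm sm' -> same i m = 1 ->
    sm m = MVar j /\ sm' m = w).
  { unfold same; intros i j w sm sm' m (_ & U) H.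
    destruct (Nat.eqb_spec i m); [subst; auto|discriminate]. }
  apply syntax_ind; simpl; intros;
  repeat match goal with H : _ /\ _ |- _ => destruct H end;
  rewrite ?upw_cw in *;
  repeat match goal with H : _ + _ = 0 |- _ => apply Nat.eq_add_0 in H; destruct H end;
  eauto.
  - destruct (E _ _ _ _ _ _ H H3) as [-> ->]; apply (occv_var Mul).
  - split_one; [erewrite (At s); eauto|erewrite (At t); eauto].
  - discriminate.
  - exfalso; congruence.
  - split_one; [erewrite (At t); eauto|].
    erewrite (Av v); eauto; constructor; eapply H0; eauto.
  - split_one; match goal with U : upd _ _ _ _ _, F : same _ m = _ |- _ =>
      apply (E _ _ _ _ _ _ U) in F || (apply same_0 in F; apply (proj1 U) in F) end.
    + erewrite (At t); eauto.
      match goal with F : _ /\ _ |- _ => destruct F as [G G'] end.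
      unfold cw in *; rewrite G, G' in *; destruct w; simpl in *.
      * match goal with F : ~ is_mvar _ |- _ => destruct F; eexists; eauto end.
      * constructor.
      * discriminate.
    + rewrite H4; apply occ_par_atR; eapply H; eauto.
  - split_one; [split_one|].
    + match goal with U : upd _ _ _ _ _, F : same _ m = _ |- _ =>
        apply (E _ _ _ _ _ _ U) in F; destruct F as [G G'] end.
      erewrite (At t), (Av v); eauto.
      unfold cw in *; rewrite G, G' in *; destruct w; simpl in *.
      * match goal with F : ~ is_mvar _ |- _ => destruct F; eexists; eauto end.
      * discriminate.
      * constructor.
    + match goal with U : upd _ _ _ _ _, F : same _ m = _ |- _ =>
        apply same_0 in F; apply (proj1 U) in F; rewrite F end.
      erewrite (At t); eauto; apply occ_sub_toL; eauto.
    + match goal with H : _ + _ = 0 |- _ => apply Nat.eq_add_0 in H; destruct H end.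
      match goal with U : upd _ _ _ _ _, F : same _ m = _ |- _ =>
        apply same_0 in F; apply (proj1 U) in F; rewrite F end.
      erewrite (Av v); eauto; apply occ_sub_toR; eapply H0; eauto.
  - apply occ_der_atR; eapply H; eauto.
Qed.

(** * Reduction *)

Section Closure.

Variable R : term -> term -> Prop.

(** Closure under constructors instead of [plug]: no commutation of left contexts is hidden in it,
    so a step can be analysed by inversion. *)
Inductive cl : term -> term -> Prop :=
| cl_root t t' : R t t' -> cl t t'
| cl_Val v v' : clv v v' -> cl (Val v) (Val v')
| cl_CutL v v' k t : clv v v' -> cl (Cut v k t) (Cut v' k t)
| cl_CutR v k t t' : cl t t' -> cl (Cut v k t) (Cut v k t')
| cl_ParR m kx ky t t' : cl t t' -> cl (Par m kx ky t) (Par m kx ky t')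
| cl_SubL m v v' k t : clv v v' -> cl (Sub m v k t) (Sub m v' k t)
| cl_SubR m v k t t' : cl t t' -> cl (Sub m v k t) (Sub m v k t')
| cl_DerR e k t t' : cl t t' -> cl (Der e k t) (Der e k t')
with clv : val -> val -> Prop :=
| clv_PairL t t' s : cl t t' -> clv (VM (MPair t s)) (VM (MPair t' s))
| clv_PairR t s s' : cl s s' -> clv (VM (MPair t s)) (VM (MPair t s'))
| clv_Lam k t t' : cl t t' -> clv (VM (MLam k t)) (VM (MLam k t'))
| clv_Bang t t' : cl t t' -> clv (VE (EBang t)) (VE (EBang t')).

Scheme cl_mut := Induction for cl Sort Prop
with clv_mut := Induction for clv Sort Prop.
Combined Scheme cl_clv_ind from cl_mut, clv_mut.

Hypothesis R_proper : forall t t', R t t' -> proper t ->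
  proper t' /\ forall i, mocc i t' <= mocc i t.

Lemma cl_proper_all :
  (forall t t', cl t t' -> proper t ->
     proper t' /\ forall i, mocc i t' <= mocc i t) /\
  (forall v v', clv v v' -> proper_v v ->
     proper_v v' /\ forall i, mocc_v i v' <= mocc_v i v).
Proof.
  assert (A : forall k i t t', (forall i, mocc i t' <= mocc i t) ->
    at_most_once k i t -> at_most_once k i t').
  { intros k i t t' H; apply at_most_once_le; auto. }
  apply cl_clv_ind; simpl; intros;
  repeat match goal with H : _ /\ _ |- _ => destruct H end; auto;
  match goal with IH : ?p -> _ /\ _, H : ?p |- _ =>
    destruct (IH H) as [? L]; clear IH end;
  (split; [repeat split; eauto|intros j;
    pose proof (L j); try pose proof (L (mup k j));
    try pose proof (L (mup ky (mup kx j))); lia]).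
  intros j; specialize (L j).
  match goal with H : forall i, mocc i t = 0 |- _ => specialize (H j) end; lia.
Qed.

Lemma cl_proper t t' : cl t t' -> proper t -> proper t'.
Proof. intros; apply (proj1 cl_proper_all _ _ H); auto. Qed.

Lemma cl_mocc t t' i : cl t t' -> proper t -> mocc i t' <= mocc i t.
Proof. intros; apply (proj1 cl_proper_all _ _ H); auto. Qed.

End Closure.

#[local] Hint Constructors cl clv : core.

(** [m_fire] covers [ax_m1], [tensor] and [lolli] together, as the form of the occurrence decides
    among them. In the same way [ms_fire] below covers [ax_e1], [ax_e2] and [bang_der]. *)
Inductive m_root : term -> term -> Prop :=
| m_fire w t r :
    occ Mul 0 (VM (ren_m (sh Mul) w)) t (ren (sh Mul) r) ->
    m_root (Cut (VM w) Mul t) r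
| m_rename n t : m_root (Cut (VM (MVar n)) Mul t) (ren (minst n) t).

Inductive ms_root : term -> term -> Prop :=
| ms_m t t' : m_root t t' -> ms_root t t'
| ms_fire w t t' :
    occ Exp 0 (VE (ren_e (sh Exp) w)) t t' ->
    ms_root (Cut (VE w) Exp t) (Cut (VE w) Exp t')
| ms_weak w t : ms_root (Cut (VE w) Exp (ren (sh Exp) t)) t.

Inductive ss_root : term -> term -> Prop :=
| ss_m t t' : m_root t t' -> ss_root t t'
| ss_ess w t : ss_root (Cut (VE w) Exp t) (subst (esubst1 w) t).

#[local] Hint Constructors m_root ms_root ss_root : core.

Notation ms := (cl ms_root).
Notation msv := (clv ms_root).
Notation ss := (cl ss_root).
Notation ssv := (clv ss_root).

(** * Properness and multiplicative counts along reduction *)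

(** [upw] gives weight 0 to the variable being renamed, so its true weight, that of [n], is added
    back once per occurrence. *)
Lemma wren_minst n g t :
  wt (wren (minst n) g) t =
  wt (upw Mul g) t + wt (fun ro j => g ro n * occs 0 ro j) t.
Proof.
  rewrite <- (proj2 (proj2 (proj2 wt_add_all))); f_equal.
  extensionality ro; extensionality i.
  unfold wren, upw, occs, same; destruct ro, i; simpl; lia.
Qed.

Lemma mocc_minst n i t :
  mocc i (ren (minst n) t) = mocc (S i) t + same i n * mocc 0 t.
Proof.
  rewrite !mocc_wt, wt_ren, wren_minst, upw_occs; f_equal.
  assert (E : same i n = 0 \/ same i n = 1).
  { unfold same; destruct (i =? n); auto. }
  destruct E as [E|E]; rewrite E.
  - apply wt_null; intros [] j; unfold occs; simpl; rewrite ?E; auto.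
  - rewrite Nat.mul_1_l; f_equal; extensionality ro; extensionality j.
    destruct ro; unfold occs; simpl; rewrite ?E; lia.
Qed.

Lemma m_root_proper t t' : m_root t t' -> proper t ->
  proper t' /\ forall i, mocc i t' <= mocc i t.
Proof.
  intros [w u r H|n u]; simpl; intros (P & O & Q); split.
  - apply (proper_ren r (sh Mul)); eapply occ_proper; eauto; [discriminate|].
    apply (proper_v_ren (VM w)); auto.
  - intros i; apply (occ_mocc_le (mup Mul i)) in H.
    rewrite mocc_ren_sh in H; change (VM (ren_m (sh Mul) w)) with (ren_v (sh Mul) (VM w)) in H.
    rewrite mocc_v_ren_sh in H; simpl in *; lia.
  - apply proper_ren; auto.
  (* When [i] is [n], the cut loses one occurrence and the body gains [mocc 0 u], which affinity
     bounds by 1. *)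
  - intros i; rewrite mocc_minst; simpl in *; change (mup Mul i) with (S i); nia.
Qed.

Lemma proper_e_mocc v i : proper_e v -> mocc_e i v = 0.
Proof. destruct v; simpl; auto; intros []; auto. Qed.

Lemma ms_root_proper t t' : ms_root t t' -> proper t ->
  proper t' /\ forall i, mocc i t' <= mocc i t.
Proof.
  intros [u u' H|w u u' H|w u]; [apply m_root_proper; auto| |]; simpl.
  - assert (A : proper_e w -> proper_e (ren_e (sh Exp) w)) by apply proper_ren_all.
    intros (P & _ & Q); repeat split; auto.
    + eapply occ_proper; eauto; simpl; auto using proper_e_mocc.
    + intros i; apply (occ_mocc_le (mup Exp i)) in H; simpl in *.
      rewrite (proper_e_mocc (ren_e _ _)) in H; auto; lia.
  - intros (P & _ & Q); split; [apply proper_ren in Q; auto|].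
    intros i; rewrite (mocc_ren_sh Exp); lia.
Qed.

Lemma ss_root_proper t t' : ss_root t t' -> proper t ->
  proper t' /\ forall i, mocc i t' <= mocc i t.
Proof.
  intros [u u' H|w u]; [apply m_root_proper; auto|]; simpl; intros (P & _ & Q).
  assert (A : forall i, proper_e (esubst1 w i)) by (intros [|i]; simpl; auto).
  split; [apply proper_subst; auto|intros i; rewrite mocc_subst; auto; simpl;
    change (mup Exp i) with i; lia].
Qed.

(** * Stability of micro-steps under renaming and commutation *)

Lemma ren_minst n r t : ren r (ren (minst n) t) = ren (minst (r Mul n)) (ren (up Mul r) t).
Proof. rewrite !ren_ren; f_equal; renaming_ext. Qed.

Lemma minst_sh n : rcomp (minst n) (sh Mul) = rid.
Proof. renaming_ext. Qed.

Lemma ren_minst_sh n k t :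
  ren (up k (minst n)) (ren (up k (sh Mul)) t) = t.
Proof.
  rewrite ren_ren, <- up_rcomp, minst_sh, up_rid; apply ren_rid.
Qed.

Lemma m_root_ren r t t' : m_root t t' -> m_root (ren r t) (ren r t').
Proof.
  intros [w u v H|n u]; simpl; [constructor|rewrite ren_minst; auto].
  apply (occ_ren _ _ _ _ _ (up Mul r)) in H; simpl in H.
  rewrite ren_m_up_sh, ren_up_sh in H; auto.
Qed.

Lemma ms_root_ren r t t' : ms_root t t' -> ms_root (ren r t) (ren r t').
Proof.
  intros [u u' H|w u v H|w u]; auto using m_root_ren; simpl.
  - apply (occ_ren _ _ _ _ _ (up Exp r)) in H; simpl in H.
    rewrite ren_e_up_sh in H; auto.
  - rewrite ren_up_sh; auto.
Qed.

Lemma ms_ren_all :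
  (forall t t', ms t t' -> forall r, ms (ren r t) (ren r t')) /\
  (forall v v', msv v v' -> forall r, msv (ren_v r v) (ren_v r v')).
Proof. apply cl_clv_ind; simpl; auto using ms_root_ren. Qed.

Lemma ms_ren r t t' : ms t t' -> ms (ren r t) (ren r t').
Proof. intros; apply ms_ren_all; auto. Qed.

(** A root redex is a cut, which begins its own left context. Attaching a continuation at the far
    end of the spine leaves that cut on top, still ready to fire. *)
Lemma ms_root_cut_at t t' k u :
  ms_root t t' -> ms_root (cut_at t k u) (cut_at t' k u).
Proof.
  intros [? ? [w s r H|n s]|w s s' H|w s]; autorewrite with at_.
  - constructor; constructor; rewrite ren_cut_at; apply occ_cut_atL; auto.
  - replace (cut_at (ren (minst n) s) k u) with
      (ren (minst n) (cut_at s k (ren (up k (sh Mul)) u))); auto.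
    rewrite ren_cut_at, ren_minst_sh; reflexivity.
  - constructor; apply occ_cut_atL; auto.
  - rewrite <- ren_cut_at; auto.
Qed.

Lemma ms_root_sub_at t t' m k u :
  ms_root t t' -> ms_root (sub_at m t k u) (sub_at m t' k u).
Proof.
  intros [? ? [w s r H|n s]|w s s' H|w s]; autorewrite with at_.
  - constructor; constructor; rewrite ren_sub_at; apply occ_sub_atL; auto.
  - replace (sub_at m (ren (minst n) s) k u) with
      (ren (minst n) (sub_at (sh Mul Mul m) s k (ren (up k (sh Mul)) u))); auto.
    rewrite ren_sub_at, ren_minst_sh; reflexivity.
  - constructor; apply occ_sub_atL; auto.
  - rewrite <- ren_sub_at; auto.
Qed.

Lemma ms_cut_atL t t' k u : ms t t' -> ms (cut_at t k u) (cut_at t' k u).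
Proof.
  intros H; revert k u; induction H; intros; autorewrite with at_;
  auto using ms_root_cut_at.
Qed.

Lemma ms_sub_atL t t' m k u : ms t t' -> ms (sub_at m t k u) (sub_at m t' k u).
Proof.
  intros H; revert m k u; induction H; intros; autorewrite with at_;
  auto using ms_root_sub_at.
Qed.

Lemma ms_cut_atR s : forall k t t', ms t t' -> ms (cut_at s k t) (cut_at s k t').
Proof. induction s; intros; autorewrite with at_; auto using ms_ren. Qed.

Lemma ms_par_atR w kx ky t t' : ms t t' -> ms (par_at w kx ky t) (par_at w kx ky t').
Proof. intros; destruct w; unfold par_at; auto using ms_cut_atR. Qed.

Lemma ms_sub_toL w v v' k t : msv v v' -> ms (sub_to w v k t) (sub_to w v' k t).
Proof. intros; destruct w; unfold sub_to; auto. Qed.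

Lemma ms_sub_toR w v k t t' : ms t t' -> ms (sub_to w v k t) (sub_to w v k t').
Proof. intros; destruct w; unfold sub_to; auto using ms_cut_atR, ms_ren. Qed.

Lemma ms_der_atR w k t t' : ms t t' -> ms (der_at w k t) (der_at w k t').
Proof. intros; destruct w; simpl; auto using ms_cut_atR. Qed.

(** What weakening erases has no multiplicative variable, and a firing consumes only a bound one.
    Value occurrences must weigh 0 because [ax_m2] removes the [n] of the cut, possibly making it a
    subject elsewhere. Applied to [cw], this says that clashes persist. *)
Lemma ms_wt_all :
  (forall t t', ms t t' -> forall g, (forall i, g RVar i = 0) ->
     (forall i, g RExp i = 0) -> proper t -> wt g t <= wt g t') /\
  (forall v v', msv v v' -> forall g, (forall i, g RVar i = 0) ->
     (forall i, g RExp i = 0) -> proper_v v -> wt_v g v <= wt_v g v').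
Proof.
  assert (U : forall k g, (forall i, g RVar i = 0) -> forall i, upw k g RVar i = 0).
  { intros [] g H [|i]; simpl; auto. }
  assert (U0 : forall k g ro, rkind ro = k -> upw k g ro 0 = 0).
  { intros [] g [] E; try discriminate; reflexivity. }
  pose proof upw_RExp as X.
  apply cl_clv_ind; simpl; intros;
  repeat match goal with H : _ /\ _ |- _ => destruct H end;
  try (repeat apply Nat.add_le_mono; auto; fail).
  destruct r as [? ? [w s r O|n s]|w s s' O|w s]; simpl in *.
  - apply occ_wt in O; destruct O as (ro & E & _ & O).
    specialize (O (upw Mul g)); rewrite U0, wt_ren, wren_sh in O; auto.
    simpl in O; rewrite wt_m_ren, wren_sh in O; lia.
  - rewrite wt_ren, wren_minst, H; lia.
  - apply occ_wt in O; destruct O as (ro & E & _ & O).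
    specialize (O (upw Exp g)); rewrite U0 in O; auto; lia.
  - destruct H1 as [P _]; rewrite proper_e_wt, wt_ren, wren_sh; auto.
Qed.

(** * Projection of micro-steps along a substitution *)

Lemma is_mvar_up k sm (f g : nat -> nat) :
  (forall i, is_mvar (sm i) \/ f (mup k i) = g (mup k i)) ->
  forall i, is_mvar (upm k sm i) \/ f i = g i.
Proof.
  intros H i; destruct k; simpl; [destruct i|]; [left; eexists; eauto| |];
  destruct (H i); auto; left; apply is_mvar_ren; auto.
Qed.

Definition minst1 (w : mulval) : nat -> mulval := fun i =>
  match i with 0 => w | S j => MVar j end.

Lemma inst_id t : inst MVar EVar t = t.
Proof.
  rewrite <- (ren_rid t) at 2.
  apply (proj2 (proj2 (proj2 inst_MVar_EVar_all)) t rid).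
Qed.

Lemma ren_inst r sm se t :
  ren r (inst sm se t) = inst (fun i => ren_m r (sm i)) (fun i => ren_e r (se i)) t.
Proof. apply ren_inst_all. Qed.

Lemma inst_ren sm se r t :
  inst sm se (ren r t) = inst (fun i => sm (r Mul i)) (fun i => se (r Exp i)) t.
Proof. apply inst_ren_all. Qed.

Lemma occ_of_linear sm se w t :
  ~ is_mvar w -> proper t -> mocc 0 t = 1 ->
  wt (cw (fun i => match i with 0 => w | S j => sm j end)) t = 0 ->
  occ Mul 0 (VM (ren_m (sh Mul) w)) (inst (upm Mul sm) (up_s Mul se) t)
    (ren (sh Mul) (inst (fun i => match i with 0 => w | S j => sm j end) se t)).
Proof.
  intros N P O C; rewrite ren_inst.
  eapply (proj2 (proj2 (proj2 upd_occ_all))) with (i := 0); auto.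
  - split; [|split; reflexivity]; intros [|i] H; [congruence|reflexivity].
  - rewrite is_mvar_ren; auto.
  - rewrite <- C; f_equal; extensionality ro; extensionality i.
    unfold cw; apply clash_ren.
Qed.

Lemma ms_root_inst t t' sm se :
  ms_root t t' -> proper t -> (forall i, is_mvar (sm i) \/ mocc i t' = mocc i t) ->
  wt (cw sm) t' = 0 -> ms_root (inst sm se t) (inst sm se t').
Proof.
  intros [? ? [w s r O|n s]|w s s' O|w s] P F C; cbn [inst inst_v inst_m].
  - do 2 constructor.
    apply (occ_inst _ _ _ _ _ (upm Mul sm) (up_s Mul se) 0) in O; auto.
    rewrite inst_up_sh in O; change (VM (ren_m (sh Mul) w)) with (ren_v (sh Mul) (VM w)) in O.
    rewrite inst_v_up_sh in O; auto.
  - destruct P as (_ & _ & P); rewrite inst_ren.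
    assert (E : (fun i => sm (minst n Mul i)) =
      fun i => match i with 0 => sm n | S j => sm j end)
      by (extensionality i; destruct i; reflexivity).
    rewrite E; clear E; change (fun i => se (minst n Exp i)) with se.
    assert (D : is_mvar (sm n) \/ ~ is_mvar (sm n)).
    { destruct (sm n); [left; eexists; auto|right..]; intros [m E]; discriminate. }
    destruct D as [[m E]|N].
    + rewrite E; constructor.
      replace (inst (fun i => match i with 0 => MVar m | S j => sm j end) _ s)
        with (ren (minst m) (inst (upm Mul sm) (up_s Mul se) s)); auto.
      rewrite ren_inst; f_equal; extensionality i; simpl.
      * destruct i; simpl; auto; rewrite ren_m_ren_m, minst_sh; apply ren_m_rid.
      * rewrite ren_e_ren_e, minst_sh; apply ren_e_rid.
    + do 2 constructor; apply occ_of_linear; auto.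
      (* The renaming removes the [n] of the cut, so a preserved count of [n] forces exactly one
         occurrence of the bound variable. *)
      * destruct (F n) as [|G]; [tauto|]; rewrite mocc_minst in G; simpl in G.
        change (mup Mul n) with (S n) in G.
        assert (E : same n n = 1) by (unfold same; rewrite Nat.eqb_refl; auto).
        rewrite E in G; lia.
      * rewrite wt_ren in C; rewrite <- C; f_equal.
        extensionality ro; extensionality i; unfold cw, wren.
        destruct ro, i; reflexivity.
  - apply ms_fire.
    apply (occ_inst _ _ _ _ _ (upm Exp sm) (up_s Exp se) 0) in O; auto.
    change (VE (ren_e (sh Exp) w)) with (ren_v (sh Exp) (VE w)) in O.
    rewrite inst_v_up_sh in O; auto.
  - rewrite inst_up_sh; auto.
Qed.

(** Linear occurrences mapped to non-variables must survive the step, so that a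
    renaming of one of them becomes a firing. *)
Lemma ms_inst_all :
  (forall t t', ms t t' -> forall sm se, proper t ->
     (forall i, is_mvar (sm i) \/ mocc i t' = mocc i t) ->
     wt (cw sm) t' = 0 -> ms (inst sm se t) (inst sm se t')) /\
  (forall v v', msv v v' -> forall sm se, proper_v v ->
     (forall i, is_mvar (sm i) \/ mocc_v i v' = mocc_v i v) ->
     wt_v (cw sm) v' = 0 -> msv (inst_v sm se v) (inst_v sm se v')).
Proof.
  apply cl_clv_ind; simpl; intros;
  repeat match goal with H : _ /\ _ |- _ => destruct H end;
  rewrite ?upw_cw in *;
  repeat match goal with H : _ + _ = 0 |- _ => apply Nat.eq_add_0 in H; destruct H end;
  auto using ms_root_inst.
  - apply cl_CutL, H; auto; intros i; destruct (H1 i); auto; right; lia.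
  - apply cl_CutR, H; auto; apply (is_mvar_up _ _ (fun i => mocc i t') (fun i => mocc i t)).
    intros i; destruct (H1 i); auto; right; lia.
  - apply ms_par_atR, H; auto; apply (is_mvar_up _ _ (fun i => mocc i t') (fun i => mocc i t)).
    apply (is_mvar_up _ _ (fun i => mocc (mup ky i) t') (fun i => mocc (mup ky i) t)).
    intros i; destruct (H1 i); auto; right; lia.
  - apply ms_sub_toL, H; auto; intros i; destruct (H1 i); auto; right; lia.
  - apply ms_sub_toR, H; auto; apply (is_mvar_up _ _ (fun i => mocc i t') (fun i => mocc i t)).
    intros i; destruct (H1 i); auto; right; lia.
  - apply ms_der_atR, H; auto; apply (is_mvar_up _ _ (fun i => mocc i t') (fun i => mocc i t)); auto.
  - constructor; apply H; auto; intros i; destruct (H1 i); auto; right; lia.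
  - constructor; apply H; auto; intros i; destruct (H1 i); auto; right; lia.
  - constructor; apply H; auto; apply (is_mvar_up _ _ (fun i => mocc i t') (fun i => mocc i t)); auto.
Qed.

Lemma ms_inst sm se t t' :
  ms t t' -> proper t -> (forall i, is_mvar (sm i) \/ mocc i t' = mocc i t) ->
  wt (cw sm) t' = 0 -> ms (inst sm se t) (inst sm se t').
Proof. intros; apply ms_inst_all; auto. Qed.

Lemma ms_subst se t t' :
  ms t t' -> proper t -> ms (inst MVar se t) (inst MVar se t').
Proof.
  intros; apply ms_inst; auto.
  - intros i; left; eexists; auto.
  - apply wt_null; intros []; reflexivity.
Qed.

(** * Strong normalization *)

Definition star {A : Type} (R : A -> A -> Prop) := clos_refl_trans_1n A R.

Lemma star_refl {A : Type} (R : A -> A -> Prop) x : star R x x.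
Proof. constructor. Qed.

Lemma star_step {A : Type} (R : A -> A -> Prop) x y : R x y -> star R x y.
Proof. econstructor; eauto; constructor. Qed.

Lemma star_trans {A : Type} (R : A -> A -> Prop) x y z : star R x y -> star R y z -> star R x z.
Proof. induction 1; auto; intros; econstructor; eauto; apply IHclos_refl_trans_1n; auto. Qed.

Lemma star_bind {A B : Type} (R : A -> A -> Prop) (S : B -> B -> Prop) (f : A -> B) :
  (forall x y, R x y -> star S (f x) (f y)) ->
  forall x y, star R x y -> star S (f x) (f y).
Proof. induction 2; [apply star_refl|eapply star_trans; eauto]. Qed.

Lemma star_map {A B : Type} (R : A -> A -> Prop) (S : B -> B -> Prop) (f : A -> B) :
  (forall x y, R x y -> S (f x) (f y)) ->
  forall x y, star R x y -> star S (f x) (f y).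
Proof. intros H; apply star_bind; intros; apply star_step; auto. Qed.

Definition sn {A : Type} (R : A -> A -> Prop) : A -> Prop := Acc (fun y x => R x y).

Lemma sn_star {A : Type} (R : A -> A -> Prop) x y : star R x y -> sn R x -> sn R y.
Proof. induction 1; auto; intros [H']; apply IHclos_refl_trans_1n, H'; auto. Qed.

Lemma sn_of_image {A B : Type} (R : A -> A -> Prop) (S : B -> B -> Prop) (f : A -> B) :
  (forall x y, R x y -> S (f x) (f y)) -> forall x, sn S (f x) -> sn R x.
Proof.
  intros H x Hx; remember (f x) as y eqn:E; revert x E.
  induction Hx as [y _ IH]; intros x ->; constructor; intros z Hz.
  apply (IH (f z)); auto.
Qed.

Lemma sn_image {A B : Type} (R : A -> A -> Prop) (S : B -> B -> Prop) (f : A -> B) :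
  (forall x c, S (f x) c -> exists y, R x y /\ c = f y) ->
  forall x, sn R x -> sn S (f x).
Proof.
  intros H x; induction 1 as [x _ IH]; constructor; intros c Hc.
  destruct (H _ _ Hc) as (y & ? & ->); apply IH; assumption.
Qed.

Lemma sn_image2 {A B C : Type} (R : A -> A -> Prop) (S : B -> B -> Prop)
    (T : C -> C -> Prop) (f : A -> B -> C) :
  (forall x y c, T (f x y) c ->
     (exists x', R x x' /\ c = f x' y) \/ (exists y', S y y' /\ c = f x y')) ->
  forall x y, sn R x -> sn S y -> sn T (f x y).
Proof.
  intros H x y Hx; revert y; induction Hx as [x Hx IH].
  intros y Hy; induction Hy as [y Hy IH']; constructor; intros c Hc.
  destruct (H _ _ _ Hc) as [(x' & ? & ->)|(y' & ? & ->)].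
  - apply IH; auto; constructor; auto.
  - apply IH'; auto.
Qed.

Definition msm (w w' : mulval) : Prop := msv (VM w) (VM w').
Definition mse (w w' : expval) : Prop := msv (VE w) (VE w').

Lemma msv_VM w v : msv (VM w) v -> exists w', v = VM w' /\ msm w w'.
Proof. unfold msm; inversion 1; subst; eauto. Qed.

Lemma msv_VE w v : msv (VE w) v -> exists w', v = VE w' /\ mse w w'.
Proof. unfold mse; inversion 1; subst; eauto. Qed.

(** Two steps can be needed: on a clash the abstraction is copied into both components. *)
Lemma msm_par_at w w' kx ky t :
  msm w w' -> star ms (par_at w kx ky t) (par_at w' kx ky t).
Proof.
  assert (H : forall a a' b b', star ms a a' -> star ms b b' ->
    star ms (cut_at a kx (cut_at (ren (sh kx) b) ky t))
      (cut_at a' kx (cut_at (ren (sh kx) b') ky t))).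
  { intros a a' b b' Ha Hb; eapply star_trans.
    - revert Ha; apply (star_map ms ms (fun a => cut_at a kx _)); intros;
      apply ms_cut_atL; auto.
    - revert Hb; apply (star_map ms ms (fun b => cut_at a' kx (cut_at (ren (sh kx) b) ky t)));
      intros; auto using ms_cut_atL, ms_cut_atR, ms_ren. }
  intros S; inversion S; subst; apply H; simpl;
  try apply star_refl; apply star_step; auto.
Qed.

Lemma msm_sub_to w w' v k t :
  msm w w' -> star ms (sub_to w v k t) (sub_to w' v k t).
Proof.
  intros S; inversion S; subst; apply star_step; unfold sub_to; simpl;
  apply cl_CutR, ms_cut_atL; auto;
  (* A clashing pair is used as a constant function, hence sits shifted under a binder; its step is
     renamed accordingly. *)
  match goal with |- ms (Val (VM (MPair (ren _ ?t) (ren _ ?s)))) (Val (VM (MPair (ren _ ?t') (ren _ ?s')))) =>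
    apply (ms_ren (sh Mul) (Val (VM (MPair t s))) (Val (VM (MPair t' s')))) end;
  auto.
Qed.

(** Every copy of a substituted value takes its own steps, and a value without copies takes none;
    hence reductions of any length. *)
Lemma star_inst_all :
  (forall v sm sm' se se', (forall i, star msm (sm i) (sm' i)) ->
     (forall i, star mse (se i) (se' i)) ->
     star msm (inst_m sm se v) (inst_m sm' se' v)) /\
  (forall v sm sm' se se', (forall i, star msm (sm i) (sm' i)) ->
     (forall i, star mse (se i) (se' i)) ->
     star mse (inst_e sm se v) (inst_e sm' se' v)) /\
  (forall v sm sm' se se', (forall i, star msm (sm i) (sm' i)) ->
     (forall i, star mse (se i) (se' i)) ->
     star msv (inst_v sm se v) (inst_v sm' se' v)) /\
  (forall t sm sm' se se', (forall i, star msm (sm i) (sm' i)) ->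
     (forall i, star mse (se i) (se' i)) ->
     star ms (inst sm se t) (inst sm' se' t)).
Proof.
  assert (Um : forall k sm sm', (forall i, star msm (sm i) (sm' i)) ->
    forall i, star msm (upm k sm i) (upm k sm' i)).
  { assert (E : forall k w w', star msm w w' ->
      star msm (ren_m (sh k) w) (ren_m (sh k) w')).
    { intros k; apply star_map; intros w w' H.
      exact (proj2 ms_ren_all _ _ H (sh k)). }
    intros [] sm sm' H [|i]; simpl; auto using star_refl. }
  assert (Ue : forall k se se', (forall i, star mse (se i) (se' i)) ->
    forall i, star mse (up_s k se i) (up_s k se' i)).
  { assert (E : forall k w w', star mse w w' ->
      star mse (ren_e (sh k) w) (ren_e (sh k) w')).
    { intros k; apply star_map; intros w w' H.
      exact (proj2 ms_ren_all _ _ H (sh k)). }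
    intros [] se se' H [|i]; simpl; auto using star_refl; apply E; auto. }
  apply syntax_ind; simpl; intros; auto using star_refl.
  - eapply star_trans.
    + apply (star_map ms msm (fun t => MPair t _)); [unfold msm; auto|eauto].
    + apply (star_map ms msm (fun s => MPair _ s)); [unfold msm; auto|eauto].
  - apply (star_map ms msm (MLam k)); [unfold msm; auto|eauto].
  - apply (star_map ms mse EBang); [unfold mse; auto|eauto].
  - apply (star_map msm msv VM); eauto.
  - apply (star_map mse msv VE); eauto.
  - apply (star_map msv ms Val); eauto.
  - eapply star_trans.
    + apply (star_map msv ms (fun v => Cut v k _)); eauto.
    + apply (star_map ms ms (Cut _ k)); eauto.
  - eapply star_trans.
    + apply (star_bind msm ms (fun w => par_at w kx ky _)); eauto using msm_par_at.
    + apply (star_map ms ms (par_at _ kx ky)); eauto 8 using ms_par_atR.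
  - eapply star_trans; [eapply star_trans|].
    + apply (star_bind msm ms (fun w => sub_to w _ k _)); eauto using msm_sub_to.
    + apply (star_map msv ms (fun v => sub_to _ v k _)); eauto using ms_sub_toL.
    + apply (star_map ms ms (sub_to _ _ k)); eauto using ms_sub_toR.
  - eapply star_trans.
    + apply (star_map mse ms (fun w => der_at w k _)); eauto.
      intros w w' S; inversion S; subst; apply ms_cut_atL; auto.
    + apply (star_map ms ms (der_at _ k)); eauto using ms_der_atR.
Qed.

Lemma star_inst sm sm' se se' t :
  (forall i, star msm (sm i) (sm' i)) -> (forall i, star mse (se i) (se' i)) ->
  star ms (inst sm se t) (inst sm' se' t).
Proof. apply star_inst_all. Qed.

Lemma inst_minst1_sh w t : inst (minst1 w) EVar (ren (sh Mul) t) = t.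
Proof. rewrite inst_ren; apply inst_id. Qed.

Lemma inst_esubst1_sh w t : inst MVar (esubst1 w) (ren (sh Exp) t) = t.
Proof. rewrite inst_ren; apply inst_id. Qed.

Lemma inst_v_id v : inst_v MVar EVar v = v.
Proof.
  rewrite <- (ren_v_rid v) at 2.
  apply (proj1 (proj2 (proj2 inst_MVar_EVar_all)) v rid).
Qed.

Lemma inst_v_minst1_sh w v : inst_v (minst1 w) EVar (ren_v (sh Mul) v) = v.
Proof. rewrite (proj1 (proj2 (proj2 inst_ren_all))); apply inst_v_id. Qed.

Lemma inst_v_esubst1_sh w v : inst_v MVar (esubst1 w) (ren_v (sh Exp) v) = v.
Proof. rewrite (proj1 (proj2 (proj2 inst_ren_all))); apply inst_v_id. Qed.

Lemma inst_minst1_MVar n t : inst (minst1 (MVar n)) EVar t = ren (minst n) t.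
Proof.
  destruct inst_MVar_EVar_all as (_ & _ & _ & H); rewrite <- H.
  f_equal; extensionality i; destruct i; reflexivity.
Qed.

(** The cut of w with t has a root step. Its contractum is then necessarily
    [inst (minst1 w) EVar t], whichever multiplicative rule applies. *)
Definition fires (w : mulval) (t : term) : Prop :=
  is_mvar w \/ (mocc 0 t = 1 /\ wt (cw (minst1 w)) t = 0).

Lemma m_root_fires w t r :
  m_root (Cut (VM w) Mul t) r -> fires w t /\ r = inst (minst1 w) EVar t.
Proof.
  inversion 1; subst.
  - split.
    + right; apply occ_wt in H3; destruct H3 as (ro & K & C & E).
      change (VM (ren_m (sh Mul) w)) with (ren_v (sh Mul) (VM w)) in *.
      rewrite clash_v_ren in C; split.
      (* Index 0 is absent from the shifted value and contractum, so the identity reads 0 + 1 =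
         [mocc 0 t] + 0. For clashes, the contractum weighs 0 because [minst1 w] sends every index
         but 0 to a variable. *)
      * specialize (E (occs 0)); rewrite <- !mocc_wt, <- mocc_v_wt, mocc_ren_sh0, mocc_v_ren_sh0 in E.
        destruct ro; try discriminate; cbn in E; lia.
      * specialize (E (cw (minst1 w))); rewrite wt_ren in E.
        rewrite wt_null in E; [|intros [] i; reflexivity].
        change (cw (minst1 w) ro 0) with (clash_v ro (VM w)) in E; lia.
    + symmetry; erewrite occ_inst_eq; [apply inst_minst1_sh|eauto|].
      symmetry; apply (inst_v_minst1_sh w (VM w)).
  - split; [left; eexists; auto|symmetry; apply inst_minst1_MVar].
Qed.

Lemma fires_m_root w t :
  proper t -> fires w t -> m_root (Cut (VM w) Mul t) (inst (minst1 w) EVar t).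
Proof.
  intros P F; assert (D : is_mvar w \/ ~ is_mvar w).
  { destruct w; [left; eexists; auto|right..]; intros [m E]; discriminate. }
  destruct D as [[n ->]|N]; [rewrite inst_minst1_MVar; auto|].
  destruct F as [F|[O C]]; [tauto|].
  pose proof (occ_of_linear MVar EVar w t N P O C) as X.
  rewrite upm_MVar in X; change (up_s Mul EVar) with EVar in X.
  rewrite inst_id in X; constructor; exact X.
Qed.

(** If the cut cannot fire now, it never will: a step of w or t that makes it fire
    lifts to the contractum, since [fires] reflects along ms. *)
Lemma sn_cut_mul w t :
  sn msv (VM w) -> sn ms t -> proper (Cut (VM w) Mul t) ->
  (fires w t -> sn ms (inst (minst1 w) EVar t)) -> sn ms (Cut (VM w) Mul t).
Proof.
  intros Hw; remember (VM w) as v eqn:E; revert w E t.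
  induction Hw as [v _ IHw]; intros w -> t Ht.
  induction Ht as [t Ht IHt]; intros P F; constructor; intros c Hc.
  assert (HP := P); destruct HP as (Pw & O & Pt); simpl in O.
  inversion Hc as [? ? Hr| |? v' ? ? Hv|? ? ? t' Hs| | | | ]; subst.
  - inversion Hr as [? ? Hm| |]; subst.
    apply m_root_fires in Hm; destruct Hm as [? ->]; apply F; auto.
  - destruct (msv_VM _ _ Hv) as (w' & -> & Hw'); apply (IHw _ Hv w'); auto.
    + constructor; auto.
    + eapply cl_proper; eauto using ms_root_proper.
    + intros F'; apply (sn_star ms (inst (minst1 w) EVar t)).
      * apply star_inst; intros [|i]; simpl; auto using star_refl, star_step.
      * apply F; destruct F' as [[n ->]|[O' C]]; [inversion Hw'|right]; split; auto.
        (* A step of [w] keeps its outermost constructor, on which alone [clash] depends. *)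
        rewrite <- C; f_equal; extensionality ro; extensionality i; destruct i; auto.
        unfold cw, minst1; inversion Hw'; destruct ro; reflexivity.
  - apply IHt; auto; [eapply cl_proper; eauto using ms_root_proper|].
    (* Together with affinity this pins the count: one occurrence after the step means exactly one
       before it, so the occurrence survives as [ms_inst] demands. *)
    assert (L : mocc 0 t' <= mocc 0 t) by (eapply cl_mocc; eauto using ms_root_proper).
    intros [[n ->]|[O' C]].
    + apply (sn_star ms (inst (minst1 (MVar n)) EVar t)).
      * apply star_step, ms_inst; auto.
        -- intros [|i]; left; eexists; reflexivity.
        -- apply wt_null; intros [] []; reflexivity.
      * apply F; left; eexists; auto.
    + apply (sn_star ms (inst (minst1 w) EVar t)).
      * apply star_step, ms_inst; auto.
        intros [|i]; [right; lia|left; eexists; reflexivity].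
      * apply F; right; split; [lia|].
        apply (proj1 ms_wt_all) with (g := cw (minst1 w)) in Hs; auto; lia.
Qed.

Definition eoccs0 : weight := fun ro i =>
  match ro with RExp => same 0 i | _ => 0 end.

(** Induction on the substituted term, then on w, then on the number of
    occurrences of e: a step of t is a step of the substituted term, a step of w
    is zero or more of them, and a replacement of e leaves it unchanged. *)
Lemma sn_cut_exp w t :
  sn msv (VE w) -> sn ms (inst MVar (esubst1 w) t) -> proper (Cut (VE w) Exp t) ->
  sn ms (Cut (VE w) Exp t).
Proof.
  (* The substituted term is generalized to any reduct [d'] of [d]: if at least one step separates
     them, the outer induction applies at once; otherwise [d'] is [d] and the inner inductions take
     over. *)
  assert (H : forall d, sn ms d -> forall d', star ms d d' ->
    forall v, sn msv v -> forall n w t, v = VE w ->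
    wt eoccs0 t = n ->
    d' = inst MVar (esubst1 w) t ->
    proper (Cut v Exp t) -> sn ms (Cut v Exp t)).
  2: { intros; eapply H; eauto using star_refl. }
  clear w t; intros d Hd; induction Hd as [d Hd IHd]; intros d' S.
  inversion S as [|d1 ? S1 S2]; [subst d'|subst; eapply IHd; eauto; fail].
  clear S; intros v Hv; induction Hv as [v Hv IHv].
  induction n as [n IHn] using (well_founded_induction lt_wf).
  intros w t -> En Ed P; constructor; intros c Hc.
  assert (HP := P); destruct HP as (Pw & _ & Pt).
  assert (Pc : proper c) by (eapply cl_proper; eauto using ms_root_proper).
  inversion Hc as [? ? Hr| |? v' ? ? Hs|? ? ? t' Hs| | | | ]; subst.
  - inversion Hr as [? ? Hm|? ? t' O|]; subst.
    + inversion Hm.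
    + eapply IHn; [|reflexivity|reflexivity| |auto].
      * apply occ_wt in O; destruct O as (ro & K & _ & E); destruct ro; try discriminate.
        change (VE (ren_e (sh Exp) w)) with (ren_v (sh Exp) (VE w)) in E.
        specialize (E eoccs0); rewrite wt_v_ren in E.
        assert (Z : wt_v (wren (sh Exp) eoccs0) (VE w) = 0).
        { apply wt_0_all; [|right; intros []]; reflexivity. }
        rewrite Z in E; change (eoccs0 RExp 0) with 1 in E; lia.
      * eapply occ_inst_eq; eauto; symmetry; apply (inst_v_esubst1_sh w (VE w)).
    + rewrite inst_esubst1_sh in Hd; constructor; auto.
  - destruct (msv_VE _ _ Hs) as (w' & -> & Hw').
    assert (St : star ms (inst MVar (esubst1 w) t) (inst MVar (esubst1 w') t)).
    { apply star_inst; intros [|i]; simpl; auto using star_refl, star_step. }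
    inversion St as [Eq|d1 ? S1 S2]; subst.
    + eapply IHv; eauto.
    + exact (IHd _ S1 _ S2 _ (Hv _ Hs) _ w' t eq_refl eq_refl eq_refl Pc).
  - exact (IHd _ (ms_subst _ _ _ Hs Pt) _ (star_refl _ _) _ (Acc_intro _ Hv)
      _ w t' eq_refl eq_refl eq_refl Pc).
Qed.

(** * From small-step reducts to micro-step normalization *)

Ltac no_root R := inversion R; subst;
  match goal with M : m_root _ _ |- _ => inversion M end.

(** The hypothesis passes to subterms: a small step of a subterm is one of the whole term, and
    normalization of the resulting term implies that of its reduced subterm, whose micro-steps
    lift. *)
Lemma sn_ms_of_ss_reducts_all :
  (forall w, proper_m w -> (forall v', ssv (VM w) v' -> sn msv v') -> sn msv (VM w)) /\
  (forall w, proper_e w -> (forall v', ssv (VE w) v' -> sn msv v') -> sn msv (VE w)) /\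
  (forall v, proper_v v -> (forall v', ssv v v' -> sn msv v') -> sn msv v) /\
  (forall t, proper t -> (forall t', ss t t' -> sn ms t') -> sn ms t).
Proof.
  apply syntax_ind; cbn [proper proper_m proper_e proper_v]; intros;
  repeat match goal with H : _ /\ _ |- _ => destruct H end; auto.
  - constructor; inversion 1.
  - apply (sn_image2 ms ms msv (fun t s => VM (MPair t s))).
    + inversion 1; subst; eauto 6.
    + apply H; auto; intros t' Ht.
      eapply (sn_of_image ms msv (fun t => VM (MPair t s))); eauto.
    + apply H0; auto; intros s' Hs.
      eapply (sn_of_image ms msv (fun s => VM (MPair t s))); eauto.
  - apply (sn_image ms msv (fun t => VM (MLam k t))); [inversion 1; subst; eauto|].
    apply H; auto; intros t' Ht.
    eapply (sn_of_image ms msv (fun t => VM (MLam k t))); eauto.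
  - constructor; inversion 1.
  - apply (sn_image ms msv (fun t => VE (EBang t))); [inversion 1; subst; eauto|].
    apply H; auto; intros t' Ht.
    eapply (sn_of_image ms msv (fun t => VE (EBang t))); eauto.
  - apply (sn_image msv ms Val).
    + inversion 1 as [? ? R| | | | | | | ]; subst; [|eauto].
      no_root R.
    + apply H; auto; intros v' Hv.
      eapply (sn_of_image msv ms Val); eauto.
  - assert (Hv : sn msv v).
    { apply H; auto; intros v' Hv.
      eapply (sn_of_image msv ms (fun v => Cut v k t)); eauto. }
    assert (Ht : sn ms t).
    { apply H0; auto; intros t' Ht.
      eapply (sn_of_image ms ms (fun t => Cut v k t)); eauto. }
    destruct v as [w|w], k.
    + apply sn_cut_mul; simpl; auto; intros F; apply H2.
      do 2 constructor; apply fires_m_root; auto.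
    + apply (sn_image2 msm ms ms (fun w t => Cut (VM w) Exp t)); auto.
      * inversion 1 as [? ? R| |? ? ? ? Hw| | | | | ]; subst; [no_root R| |eauto].
        destruct (msv_VM _ _ Hw) as (w' & -> & ?); eauto.
      * eapply (sn_of_image msm msv VM); auto.
    + apply (sn_image2 mse ms ms (fun w t => Cut (VE w) Mul t)); auto.
      * inversion 1 as [? ? R| |? ? ? ? Hw| | | | | ]; subst; [no_root R| |eauto].
        destruct (msv_VE _ _ Hw) as (w' & -> & ?); eauto.
      * eapply (sn_of_image mse msv VE); auto.
    + apply sn_cut_exp; simpl; auto; apply H2; constructor.
      rewrite <- (proj2 (proj2 (proj2 subst_inst_all))); apply ss_ess.
  - apply (sn_image ms ms (fun t => Par m kx ky t)).
    + inversion 1 as [? ? R| | | | | | | ]; subst; [|eauto].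
      no_root R.
    + apply H; auto; intros t' Ht.
      eapply (sn_of_image ms ms (fun t => Par m kx ky t)); eauto.
  - apply (sn_image2 msv ms ms (fun v t => Sub m v k t)).
    + inversion 1 as [? ? R| | | | | | | ]; subst; eauto 6.
      no_root R.
    + apply H; auto; intros v' Hv.
      eapply (sn_of_image msv ms (fun v => Sub m v k t)); eauto.
    + apply H0; auto; intros t' Ht.
      eapply (sn_of_image ms ms (fun t => Sub m v k t)); eauto.
  - apply (sn_image ms ms (fun t => Der e k t)).
    + inversion 1 as [? ? R| | | | | | | ]; subst; [|eauto].
      no_root R.
    + apply H; auto; intros t' Ht.
      eapply (sn_of_image ms ms (fun t => Der e k t)); eauto.
Qed.

Lemma sn_ss_ms t : sn ss t -> proper t -> sn ms t.
Proof.
  induction 1 as [t _ IH]; intros P; apply sn_ms_of_ss_reducts_all; auto.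
  intros t' Ht; apply IH; auto; eapply cl_proper; eauto using ss_root_proper.
Qed.

(** * Plugging *)

Scheme vctx_mut := Induction for vctx Sort Prop
with gctx_mut := Induction for gctx Sort Prop.
Combined Scheme ctx_ind from vctx_mut, gctx_mut.

Inductive top : kind -> nat -> val -> term -> term -> Prop :=
| top_var K i w : top K i w (Val (var K i)) (Val w)
| top_par i s u kx ky t :
    top Mul i (VM (MPair s u)) (Par i kx ky t) (par_at (MPair s u) kx ky t)
| top_sub i ky s v k t :
    top Mul i (VM (MLam ky s)) (Sub i v k t) (sub_to (MLam ky s) v k t)
| top_der i w k t : top Exp i (VE w) (Der i k t) (der_at w k t).

#[local] Hint Constructors top : core.

Lemma top_occ K i w t t' : top K i w t t' -> occ K i w t t'.
Proof. destruct 1; auto. Qed.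

Lemma shift_at_dadd d d' K i : shift (dadd d d') K i = shift d' K (shift d K i).
Proof. unfold shift, dadd; lia. Qed.

Lemma ren_v_shift_dadd d d' w :
  ren_v (shift (dadd d d')) w = ren_v (shift d') (ren_v (shift d) w).
Proof. rewrite ren_v_ren_v, shift_dadd; reflexivity. Qed.

Lemma occ_lplug L : forall K i w t t',
  occ K (shift (ldepth L) K i) (ren_v (shift (ldepth L)) w) t t' ->
  occ K i w (lplug L t) (lplug L t').
Proof.
  induction L; cbn [ldepth lplug]; intros K i w s s' H;
  rewrite ?shift_at_dadd, ?ren_v_shift_dadd in H; auto.
  rewrite shift_d0, ren_v_rid in H; auto.
Qed.

Lemma top_plug b b' K :
  (forall V i w, (K = Mul -> mult_v V) ->
     top K (shift (vdepth V) K i) (ren_v (shift (vdepth V)) w) b b' ->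
     occ K i w (vplug V b) (vplug V b')) /\
  (forall C i w, (K = Mul -> mult C) ->
     top K (shift (gdepth C) K i) (ren_v (shift (gdepth C)) w) b b' ->
     occ K i w (plug C b) (plug C b')).
Proof.
  apply ctx_ind; cbn [vdepth gdepth vplug plug mult mult_v]; intros;
  rewrite ?shift_at_dadd, ?ren_v_shift_dadd in *;
  auto using occ_cut_atL, occ_sub_atL, occ_lplug.
  - rewrite shift_d0, ren_v_rid in H0; auto using top_occ.
  - destruct K; [destruct H0; auto|].
    do 2 constructor; apply H; auto; discriminate.
Qed.

Lemma occ_plug K C i w b b' :
  (K = Mul -> mult C) ->
  top K (shift (gdepth C) K i) (ren_v (shift (gdepth C)) w) b b' ->
  occ K i w (plug C b) (plug C b').
Proof. apply top_plug. Qed.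

(** A context is read off the derivation, and it is multiplicative because a multiplicative
    occurrence never crosses a bang. On the left of a cut or sub, the plugged value context is
    already a value, so [cut_at] and [sub_at] reduce to the plain constructors. *)
Lemma plug_of_occ_all :
  (forall K i w t t', occ K i w t t' -> K = Mul -> exists M b b',
     mult M /\ top K (shift (gdepth M) K i) (ren_v (shift (gdepth M)) w) b b' /\
     t = plug M b /\ t' = plug M b') /\
  (forall K i w v v', occv K i w v v' -> K = Mul -> exists V b b',
     mult_v V /\ top K (shift (vdepth V) K i) (ren_v (shift (vdepth V)) w) b b' /\
     Val v = vplug V b /\ Val v' = vplug V b').
Proof.
  assert (T : forall i w b b', top Mul i w b b' -> exists M c c',
    mult M /\ top Mul (shift (gdepth M) Mul i) (ren_v (shift (gdepth M)) w) c c' /\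
    b = plug M c /\ b' = plug M c').
  { intros i w b b' H; exists (CVal VHole), b, b'; simpl.
    rewrite shift_d0, ren_v_rid; auto. }
  apply occ_occv_ind; intros; subst; try discriminate; auto;
  try match goal with H : Mul = Mul -> _ |- _ =>
    destruct (H eq_refl) as (C & b & b' & M & B & E & E'); clear H; subst end.
  - exists (CVal C), b, b'; auto.
  - exists (CCut C k t), b, b'; repeat split; auto; simpl;
    rewrite <- ?E, <- ?E'; autorewrite with at_; auto.
  - exists (CLeft (LCut v k LHole) C), b, b'; repeat split; auto; simpl.
    rewrite !shift_at_dadd, !ren_v_shift_dadd, shift_d0, ren_v_rid; auto.
  - exists (CLeft (LPar m kx ky LHole) C), b, b'; repeat split; auto; simpl.
    rewrite !shift_at_dadd, !ren_v_shift_dadd, shift_d0, ren_v_rid; auto.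
  - exists (CSub m C k t), b, b'; repeat split; auto; simpl;
    rewrite <- ?E, <- ?E'; autorewrite with at_; auto.
  - exists (CLeft (LSub m v k LHole) C), b, b'; repeat split; auto; simpl.
    rewrite !shift_at_dadd, !ren_v_shift_dadd, shift_d0, ren_v_rid; auto.
  - exists (CLeft (LDer e k LHole) C), b, b'; repeat split; auto; simpl.
    rewrite !shift_at_dadd, !ren_v_shift_dadd, shift_d0, ren_v_rid; auto.
  - exists VHole, (Val (var Mul i)), (Val w); simpl.
    rewrite shift_d0, ren_v_rid; auto.
  - exists (VPairL C s), b, b'; auto.
  - exists (VPairR t C), b, b'; auto.
  - exists (VLam k C), b, b'; repeat split; auto; simpl.
    rewrite !shift_at_dadd, !ren_v_shift_dadd; auto.
Qed.

(** * Comparison with the rules closed under contexts *)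

Lemma into_comp k C : into k C = rcomp (shift (gdepth C)) (sh k).
Proof. apply shift_dadd'. Qed.

Lemma root_ms a t t' : root a t t' -> a <> ess -> ms_root t t'.
Proof.
  assert (Z : forall C K, shift (gdepth C) K 0 = gdepth C K).
  { intros; apply Nat.add_0_r. }
  assert (O : forall K C w b b', (K = Mul -> mult C) ->
    top K (gdepth C K) (ren_v (into K C) w) b b' ->
    occ K 0 (ren_v (sh K) w) (plug C b) (plug C b')).
  { intros K C w b b' H T; apply occ_plug; auto.
    rewrite Z, ren_v_ren_v, <- into_comp; auto. }
  destruct 1; intros N; try congruence.
  - do 2 constructor; unfold sh at 2; rewrite <- H0.
    apply (O Mul M (VM v)); auto; apply (top_var Mul).
  - auto.
  - do 2 constructor; unfold sh at 2; rewrite <- H0.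
    apply (O Mul M (VM (MPair s u))); auto; apply top_par.
  - do 2 constructor; unfold sh at 2; rewrite <- H0.
    apply (O Mul M (VM (MLam ky s))); auto; apply top_sub.
  - apply ms_fire, (O Exp C (VE v)); [discriminate|apply (top_var Exp)].
  - apply ms_fire, (O Exp C (VE (EVar f))); [discriminate|apply top_der].
  - apply ms_fire, (O Exp C (VE (EBang s))); [discriminate|apply top_der].
  - subst; apply ms_weak.
Qed.

Lemma ms_lplug L t t' : ms t t' -> ms (lplug L t) (lplug L t').
Proof. induction L; simpl; auto. Qed.

Lemma ms_plug t t' : ms t t' ->
  (forall V, ms (vplug V t) (vplug V t')) /\ (forall C, ms (plug C t) (plug C t')).
Proof.
  intros H; apply ctx_ind; simpl; auto using ms_cut_atL, ms_sub_atL, ms_lplug.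
Qed.

(** Normalization passes to smaller relations: hence micro-steps are included in [ms] here and, in
    the opposite direction, [ss] in [step_ss] below. *)
Lemma step_ms_ms t t' : step_ms t t' -> ms t t'.
Proof.
  assert (S : forall a, a <> ess -> step a t t' -> ms t t').
  { intros a N [C u u' H]; apply ms_plug; constructor; eapply root_ms; eauto. }
  unfold step_ms, step_m; intros H;
  repeat (destruct H as [H|H]); eapply S; eauto; discriminate.
Qed.

Definition ss_rule (a : rule) : Prop :=
  match a with ax_m1 | ax_m2 | tensor | lolli | ess => True | _ => False end.

Lemma m_root_root t t' : m_root t t' -> exists a, ss_rule a /\ root a t t'.
Proof.
  intros [w u r O|n u]; [|exists ax_m2; repeat constructor].
  destruct (proj1 plug_of_occ_all _ _ _ _ _ O eq_refl) as (M & b & b' & HM & T & -> & E).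
  change (VM (ren_m (sh Mul) w)) with (ren_v (sh Mul) (VM w)) in T.
  rewrite ren_v_ren_v, <- into_comp in T; unfold shift at 1 in T.
  rewrite Nat.add_0_r in T; symmetry in E.
  remember (ren_v (into Mul M) (VM w)) as w' eqn:Ew; remember (gdepth M Mul) as i eqn:Ei.
  remember Mul as K eqn:EK in T; destruct T; subst; try discriminate.
  - exists ax_m1; split; [exact I|]; apply root_ax_m1; auto.
  - destruct w as [|s0 u0|]; try discriminate; injection Ew; intros -> ->.
    exists tensor; split; [exact I|]; apply root_tensor; auto.
  - destruct w as [| |k' s0]; try discriminate; injection Ew; intros -> ->.
    exists lolli; split; [exact I|]; apply root_lolli; auto.
Qed.

(** Keeping a value context, not a general one, lets the step be placed on the left of a cut or sub
    through [CCut] and [CSub]. *)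
Definition step_v (a : rule) (v v' : val) : Prop := exists V t t',
  root a t t' /\ vplug V t = Val v /\ vplug V t' = Val v'.

Lemma ss_step_all :
  (forall t t', ss t t' -> exists a, ss_rule a /\ step a t t') /\
  (forall v v', ssv v v' -> exists a, ss_rule a /\ step_v a v v').
Proof.
  apply cl_clv_ind; intros;
  try match goal with H : exists a, _ |- _ => destruct H as (a & A & S) end;
  try match goal with S : step_v _ _ _ |- _ =>
    destruct S as (V & u & u' & S & E & E'); exists a; split; auto end;
  try match goal with S : step _ _ _ |- _ =>
    destruct S as [C u u' S]; exists a; split; auto end.
  - destruct r as [t t' Hm|w t].
    + destruct (m_root_root _ _ Hm) as (a & ? & ?); exists a; split; auto.
      apply (step_intro a (CVal VHole)); auto.
    + exists ess; split; [exact I|]; apply (step_intro ess (CVal VHole)); constructor.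
  - rewrite <- E, <- E'; apply (step_intro a (CVal V)); auto.
  - rewrite <- (cut_at_Val v), <- (cut_at_Val v'), <- E, <- E'.
    apply (step_intro a (CCut V k t)); auto.
  - apply (step_intro a (CLeft (LCut v k LHole) C)); auto.
  - apply (step_intro a (CLeft (LPar m kx ky LHole) C)); auto.
  - rewrite <- (sub_at_Val m v), <- (sub_at_Val m v'), <- E, <- E'.
    apply (step_intro a (CSub m V k t)); auto.
  - apply (step_intro a (CLeft (LSub m v k LHole) C)); auto.
  - apply (step_intro a (CLeft (LDer e k LHole) C)); auto.
  - exists (VPairL C s), u, u'; auto.
  - exists (VPairR t C), u, u'; auto.
  - exists (VLam k C), u, u'; auto.
  - exists (VBang C), u, u'; auto.
Qed.

Lemma ss_step_ss t t' : ss t t' -> step_ss t t'.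
Proof.
  intros H; destruct (proj1 ss_step_all _ _ H) as (a & A & S).
  unfold step_ss, step_m; destruct a; simpl in A; tauto.
Qed.

(** * Infinite sequences and accessibility *)

(** Classically, a term that is not accessible has a reduct that is not accessible either; choice
    iterates this into an infinite sequence. *)
Lemma SN_sn (R : term -> term -> Prop) t : SN R t -> sn R t.
Proof.
  intros H; apply NNPP; intros N; apply H.
  assert (X : forall x : {x | ~ sn R x}, exists y : {x | ~ sn R x},
    R (proj1_sig x) (proj1_sig y)).
  { intros [x Hx]; apply NNPP; intros C; apply Hx; constructor; intros y Hy.
    apply NNPP; intros Ny; apply C; exists (exist _ y Ny); auto. }
  destruct (functional_choice _ X) as [next Hnext].
  exists (fun n => proj1_sig (Nat.iter n next (exist _ t N))); auto.
Qed.

Lemma sn_SN (R : term -> term -> Prop) t : sn R t -> SN R t.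
Proof.
  induction 1 as [t _ IH]; intros (f & E & F).
  apply (IH (f 1)); [rewrite <- E; apply F|].
  exists (fun n => f (S n)); split; auto.
Qed.

Lemma sn_incl {A : Type} (R S : A -> A -> Prop) :
  (forall x y, R x y -> S x y) -> forall x, sn S x -> sn R x.
Proof. intros H; apply (sn_of_image R S (fun x => x) H). Qed.

Theorem theorem12p3 (t : term) :
  proper t -> SN step_ss t -> SN step_ms t.
Proof.
  intros P H; apply sn_SN, (sn_incl step_ms ms step_ms_ms), sn_ss_ms; auto.
  apply (sn_incl ss step_ss ss_step_ss), SN_sn; auto.
Qed.
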